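(* (i) $\kappa(m,n)=1$ for all pairs $(m,n)$ with $3\le m\le 8$ and $m\le n<u_{\mathbb{Z}}(m)-1$; explicitly, for $m=3$, $n\in\{3,4\}$; $m=4$, $n\in\{4,5\}$; $m=5$, $n\in\{5,6\}$; $m=6$, $6\le n\le 11$; $m=7$, $7\le n\le 13$; $m=8$, $8\le n\le 14$. (ii) For $n=u_{\mathbb{Z}}(m)-1$: $1\le\kappa(3,5)\le 2$, $1\le\kappa(4,6)\le 2$, $\kappa(5,7)=1$, $\kappa(6,12)=2$, $\kappa(7,14)=2$, and $\kappa(8,15)=1$.
   Context: A $\mathbb{Z}$-lattice means a free $\mathbb{Z}$-module of finite rank with a positive definite integer-valued symmetric bilinear form $B$. A $\mathbb{Z}$-lattice $\ell$ is represented by $L$ if there is a linear map $\sigma:\ell\to L$ with $B(\sigma x,\sigma y)=B(x,y)$. $u_{\mathbb{Z}}(m)$ denotes the minimal rank of a $\mathbb{Z}$-lattice representing all $\mathbb{Z}$-lattices of rank $m$; it is known that $u_{\mathbb{Z}}(3)=6$, $u_{\mathbb{Z}}(4)=7$, $u_{\mathbb{Z}}(5)=8$, $u_{\mathbb{Z}}(6)=13$, $u_{\mathbb{Z}}(7)=15$, $u_{\mathbb{Z}}(8)=16$. For positive integers $m\le n$, $\kappa(m,n)$ is the largest integer $k$ such that for any $\mathbb{Z}$-lattices $\ell_1,\dots,\ell_k$ of rank $m$ there is a $\mathbb{Z}$-lattice of rank $n$ representing every $\ell_i$. *)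

(* Defs.v *)
From HB Require Import structures.
From mathcomp Require Import all_boot all_order all_algebra.

Set Implicit Arguments.
Unset Strict Implicit.
Unset Printing Implicit Defensive.

Import GRing.Theory Num.Theory.
Local Open Scope ring_scope.

(* [vectType] makes sense over any nontrivial ring: a [vectType int] is a
   Z-module linearly isomorphic to 'rV[int]_n for n = [dim _], that is, a free
   Z-module of finite rank. [{dot V for idfun}] is the type of int-valued
   symmetric positive definite bilinear forms on V. *)
Record zlattice := ZLattice {
  zcarrier :> vectType int;
  zform : {dot zcarrier for idfun}
}.

Definition zrank (L : zlattice) : nat := dim L.

Definition represents (L l : zlattice) : Prop :=
  exists sigma : {linear l -> L},
    forall x y : l, zform L (sigma x) (sigma y) = zform l x y.

Definition universal (m : nat) (L : zlattice) : Prop :=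
  forall l : zlattice, zrank l = m -> represents L l.

(* The relation u_Z(m) = u. *)
Definition is_uZ (m u : nat) : Prop :=
  (exists L : zlattice, zrank L = u /\ universal m L) /\
  (forall L : zlattice, universal m L -> (u <= zrank L)%N).

Definition simultaneously_represented (m n k : nat) : Prop :=
  forall l : 'I_k -> zlattice, (forall i, zrank (l i) = m) ->
    exists L : zlattice, zrank L = n /\ forall i, represents L (l i).

(* The relation kappa(m, n) = k. *)
Definition is_kappa (m n k : nat) : Prop :=
  simultaneously_represented m n k /\
  (forall k' : nat, simultaneously_represented m n k' -> (k' <= k)%N).

(* The values of u_Z(m), 3 <= m <= 8, quoted from the literature. *)
Definition known_uZ_values : Prop :=
  [/\ is_uZ 3 6, is_uZ 4 7 & is_uZ 5 8] /\
  [/\ is_uZ 6 13, is_uZ 7 15 & is_uZ 8 16].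

(* Main.v *)
(** A lattice representing I_m contains m orthonormal vectors e. Projecting any
    further represented lattice away from them changes its Gram matrix G into
    G - sum_e l_e l_e^T, where l_e is the integral vector of products with e; this
    is positive semidefinite, so there are finitely many l_e, and its rank is at
    most rank L - m. For m = 3, 4, 5 a search over the l_e, up to signs and order,
    therefore refutes the existence of L for suitable test lattices.

    For m = 6, 7, 8 no nonzero l is possible with E_m, so E_m is orthogonal to I_m
    and rank L >= 2m. If rank L = 2m, no vector orthogonal to I_m has norm 1, so each
    root of a further copy of A_6 lies over Q in the span of I_m or of E_m; hence so
    does the whole A_6, as its diagram is connected. Two full rank families of
    vectors of L have Gram determinants whose product is a square, and this excludes
    A_6 when m = 6 and an overlattice of rank 7 and determinant 11 when m = 7.

    Lower bounds for kappa come from orthogonal sums. *)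

Require Import Defs.
From Stdlib Require Import Classical ZArith.
From HB Require Import structures.
From mathcomp Require Import all_boot all_order all_algebra.
From mathcomp Require Import ssrZ zify ring.

Set Implicit Arguments.
Unset Strict Implicit.
Unset Printing Implicit Defensive.

Import Order.TTheory GRing.Theory Num.Theory VectorInternalTheory.
Local Open Scope ring_scope.

(** * Orthonormal families and residuals *)

Section Form.
Variable L : zlattice.
Implicit Types (x y z e : L) (es xs ys : seq L).

Definition bz x y : Z := Z_of_int (zform L x y).
Definition sc (c : Z) x : L := int_of_Z c *: x.

Lemma bzC x y : bz x y = bz y x.
Proof. by rewrite /bz hermC expr0 mul1r. Qed.
Lemma bzDl x y z : bz (x + y) z = bz x z + bz y z.
Proof. by rewrite /bz linearDl rmorphD. Qed.
Lemma bzDr x y z : bz z (x + y) = bz z x + bz z y.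
Proof. by rewrite bzC bzDl !(bzC z). Qed.
Lemma bzNl x z : bz (- x) z = - bz x z.
Proof. by rewrite /bz linearNl rmorphN. Qed.
Lemma bzNr x z : bz z (- x) = - bz z x.
Proof. by rewrite bzC bzNl bzC. Qed.
Lemma bz0l z : bz 0 z = 0.
Proof. by rewrite /bz linear0l. Qed.
Lemma bz0r z : bz z 0 = 0.
Proof. by rewrite bzC bz0l. Qed.
Lemma bzZl c x z : bz (sc c x) z = c * bz x z.
Proof. by rewrite /bz linearZl_LR rmorphM /= int_of_ZK. Qed.
Lemma bzZr c x z : bz z (sc c x) = c * bz z x.
Proof. by rewrite bzC bzZl bzC. Qed.
Lemma bz_suml I (r : seq I) (P : pred I) (F : I -> L) z :
  bz (\sum_(i <- r | P i) F i) z = \sum_(i <- r | P i) bz (F i) z.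
Proof. exact: (big_morph (bz^~ z) (fun x y => bzDl x y z) (bz0l z)). Qed.
Lemma bz_sumr I (r : seq I) (P : pred I) (F : I -> L) z :
  bz z (\sum_(i <- r | P i) F i) = \sum_(i <- r | P i) bz z (F i).
Proof. exact: (big_morph (bz z) (fun x y => bzDr x y z) (bz0r z)). Qed.
Lemma bz_gt0 x : x != 0 -> 0 < bz x x.
Proof. by move/(neq0_dnorm_gt0 (s := zform L)); rewrite /bz; move: (zform L x x) => a; lia. Qed.
Lemma bz_ge0 x : 0 <= bz x x.
Proof. by case: (eqVneq x 0) => [->|/bz_gt0/ltW //]; rewrite bz0l. Qed.
Lemma bz_eq0 x : bz x x = 0 -> x = 0.
Proof. by move=> h; apply/eqP; apply: contraTT isT => /bz_gt0; rewrite h ltxx. Qed.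

(** The middle factor is the Gram matrix of a basis of [L], the same for all [v] and [w]; this later
    makes products of full rank Gram determinants squares. *)
Lemma gram_mulmx n (v w : 'I_n -> L) :
  (\matrix_(i, j) bz (v i) (w j)) =
  (\matrix_(i, k) Z_of_int (v2r (v i) 0 k)) *m
  (\matrix_(k, l) bz (r2v (delta_mx 0 k)) (r2v (delta_mx 0 l))) *m
  (\matrix_(i, k) Z_of_int (v2r (w i) 0 k))^T.
Proof.
have dec x : x = \sum_k sc (Z_of_int (v2r x 0 k)) (r2v (delta_mx 0 k)).
  rewrite -{1}[x]v2rK {1}[v2r x]row_sum_delta linear_sum; apply: eq_bigr => k _.
  by rewrite linearZ /= /sc Z_of_intK.
apply/matrixP => i j; rewrite !mxE {1}[w j]dec bz_sumr.
apply: eq_bigr => l _; rewrite bzZr !mxE mulrC; congr (_ * _).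
rewrite {1}[v i]dec bz_suml; apply: eq_bigr => k _.
by rewrite bzZl !mxE.
Qed.

Lemma dependence xs : (dim L < size xs)%N ->
  exists2 c : 'I_(size xs) -> Z, exists i, c i != 0 &
    forall z, \sum_i c i * bz xs`_i z = 0.
Proof.
set n := size xs => lt_dn.
(* Coordinates are padded with zero columns to a square matrix; column [dim L] is zero, so the
   determinant vanishes. *)
pose P : 'M[Z]_n := \matrix_(i, j)
  oapp (fun k : 'I_(dim L) => Z_of_int (v2r xs`_i 0 k)) 0 (insub (val j)).
have: \det P == 0.
  rewrite -det_tr (expand_det_row _ (Ordinal lt_dn)) big1 // => j _.
  by rewrite !mxE insubF ?ltnn // mul0r.
case/det0P => c c0 cP; exists (c 0) => [|z].
  by apply/existsP; apply: contra_neqT c0 => /existsPn h; apply/rowP => i;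
     rewrite mxE; apply/eqP; move: (h i); rewrite negbK.
pose s : L := \sum_i sc (c 0 i) xs`_i.
suff s0 : s = 0.
  transitivity (bz s z); last by rewrite s0 bz0l.
  by rewrite bz_suml; apply: eq_bigr => i _; rewrite bzZl.
apply: (can_inj v2rK); rewrite linear0; apply/rowP => k; rewrite mxE.
rewrite /s linear_sum summxE; apply: (can_inj Z_of_intK).
have kn : (k < n)%N := ltn_trans (ltn_ord k) lt_dn.
have h := congr1 (fun M : 'rV_n => M 0 (Ordinal kn)) cP; rewrite !mxE in h.
rewrite rmorph0 -[RHS]h rmorph_sum; apply: eq_bigr => i _.
rewrite /sc linearZ !mxE rmorphM /= int_of_ZK; congr (_ * _).
by case: insubP => [k' _ /val_inj -> //|]; rewrite /= ltn_ord.
Qed.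

Definition onb es := uniq es /\ {in es &, forall x y, bz x y = (x == y)%:R}.

Definition res es z : L := z - \sum_(e <- es) sc (bz z e) e.

Lemma onb_sum es e (F : L -> Z) : onb es -> e \in es ->
  \sum_(x <- es) F x * bz x e = F e.
Proof.
case=> Ue Oe ee; rewrite (bigD1_seq e) //= Oe // eqxx mulr1 big_seq_cond big1 ?addr0 //.
by move=> x /andP[xe ne]; rewrite Oe // (negbTE ne) mulr0.
Qed.

Lemma onb_cons es y : onb es -> bz y y = 1 -> {in es, forall e, bz y e = 0} ->
  onb (y :: es).
Proof.
case=> ue oe y1 oy; have ny : y \notin es by apply/negP => /oy; rewrite y1.
split=> [|a b]; first by rewrite /= ny.
rewrite !inE => /orP[/eqP->|ae] /orP[/eqP->|be]; rewrite ?eqxx //.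
- by rewrite oy //; case: eqVneq => // yb; rewrite yb be in ny.
- by rewrite bzC oy //; case: eqVneq => // yb; rewrite -yb ae in ny.
- exact: oe.
Qed.

Lemma res_orth es z e : onb es -> e \in es -> bz (res es z) e = 0.
Proof.
move=> oe ee; rewrite /res bzDl bzNl bz_suml.
under eq_bigr do rewrite bzZl.
by rewrite onb_sum // subrr.
Qed.

Lemma bz_res_orth es z y : (forall e, e \in es -> bz e y = 0) ->
  bz (res es z) y = bz z y.
Proof.
move=> oy; rewrite /res bzDl bzNl bz_suml big_seq big1 ?subr0 // => e ee.
by rewrite bzZl oy ?mulr0.
Qed.

Lemma bz_res es z y : onb es ->
  bz (res es z) (res es y) = bz z y - \sum_(e <- es) bz z e * bz y e.
Proof.
move=> oe; rewrite bz_res_orth; last by move=> e ee; rewrite bzC res_orth.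
rewrite /res bzDr bzNr bz_sumr; congr (_ - _); apply: eq_bigr => e _.
by rewrite bzZr mulrC.
Qed.

(** The vectors [es ++ ys] are dependent. Pairing a relation with each member of [es] kills the
    coefficients there, and the others form a kernel vector of the Gram matrix of [ys]. *)
Lemma gram_det0 es ys : onb es -> (dim L < size es + size ys)%N ->
    {in ys & es, forall y e, bz y e = 0} ->
  \det (\matrix_(i < size ys, j < size ys) bz ys`_i ys`_j) = 0.
Proof.
move=> oe; rewrite -size_cat => /dependence[c [i0 ci0] hc] oy.
pose d k := oapp c 0 (insub k).
have dE (i : 'I_(size (es ++ ys))) : c i = d i by rewrite /d valK.
have {}hc z : \sum_(k < size es) d k * bz es`_k z
    + \sum_(k < size ys) d (size es + k)%N * bz ys`_k z = 0.
  rewrite -[RHS](hc z); under [RHS]eq_bigr do rewrite dE.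
  rewrite -(big_mkord xpredT (fun k => d k * bz (es ++ ys)`_k z)) size_cat.
  rewrite (big_cat_nat (n := size es)) ?leq_addr //=; congr (_ + _).
    by rewrite big_mkord; apply: eq_bigr => i _; rewrite nth_cat ltn_ord.
  rewrite -[X in \big[_/_]_(X <= _ < _) _]add0n big_addn addKn big_mkord; apply: eq_bigr => i _.
  by rewrite nth_cat ltnNge leq_addl /= addnK addnC.
have de k : (k < size es)%N -> d k = 0.
  move=> lk; have := hc es`_k; rewrite [X in _ + X]big1 ?addr0; last first.
    by move=> i _; rewrite oy ?mulr0 ?mem_nth.
  case: oe => Ue Oe; rewrite (bigD1 (Ordinal lk)) //= Oe ?mem_nth // eqxx mulr1.
  rewrite big1 ?addr0 // => i ni; rewrite Oe ?mem_nth // nth_uniq //.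
  by rewrite -val_eqE /= in ni; rewrite (negbTE ni) mulr0.
apply/eqP/det0P; exists (\row_k d (size es + k)%N).
  apply: contraNneq ci0 => h; rewrite dE.
  case: (ltnP i0 (size es)) => [/de -> //|le].
  have li : (i0 - size es < size ys)%N by have := size_cat es ys; have := ltn_ord i0; lia.
  have := congr1 (fun M : 'rV_(size ys) => M 0 (Ordinal li)) h; rewrite !mxE /=.
  by rewrite subnKC // => ->.
apply/rowP => j; rewrite !mxE -[RHS](hc ys`_j) [X in _ = X + _]big1 ?add0r.
  by apply: eq_bigr => i _; rewrite !mxE.
by move=> k _; rewrite de // mul0r.
Qed.

End Form.

(** * Semidefiniteness tests on integer tables *)

(* The functions meant to be run use [Z.add], [Z.sub], ... instead of the ring
   operations, which hide them behind canonical structures, and [if] instead of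
   [&&] and [||], which the virtual machine evaluates strictly. *)
Definition table := seq (seq Z).
Definition get (T : table) i j : Z := nth Z0 (nth [::] T i) j.
Definition mk m (f : nat -> nat -> Z) : table :=
  [seq [seq f i j | j <- iota 0 m] | i <- iota 0 m].
Definition shrink m (T : table) (l : seq Z) : table :=
  mk m (fun i j => Z.sub (get T i j) (Z.mul (nth Z0 l i) (nth Z0 l j))).

(* Fraction-free symmetric elimination; a zero pivot forces a zero row. *)
Fixpoint psdb n (T : table) : bool :=
  if n is n'.+1 then
    let a := get T 0 0 in
    if Z.ltb Z0 a then
      psdb n' (mk n' (fun i j =>
        Z.sub (Z.mul a (get T i.+1 j.+1)) (Z.mul (get T 0 i.+1) (get T 0 j.+1))))
    else if Z.eqb a Z0 && all (fun j => Z.eqb (get T 0 j.+1) Z0) (iota 0 n')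
      then psdb n' (mk n' (fun i j => get T i.+1 j.+1)) else false
  else true.

Fixpoint pdb n (T : table) : bool :=
  if n is n'.+1 then
    let a := get T 0 0 in
    if Z.ltb Z0 a then
      pdb n' (mk n' (fun i j =>
        Z.sub (Z.mul a (get T i.+1 j.+1)) (Z.mul (get T 0 i.+1) (get T 0 j.+1))))
    else false
  else true.

Definition symb n (T : table) : bool :=
  all (fun i => all (fun j => Z.eqb (get T i j) (get T j i)) (iota 0 n)) (iota 0 n).

Lemma get_mk m f i j : (i < m)%N -> (j < m)%N -> get (mk m f) i j = f i j.
Proof.
move=> im jm; rewrite /get /mk (nth_map 0%N) ?size_iota //.
by rewrite (nth_map 0%N) ?size_iota // !nth_iota.
Qed.

Lemma ZsubE (a b : Z) : Z.sub a b = a - b. Proof. by []. Qed.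
Lemma ZaddE (a b : Z) : Z.add a b = a + b. Proof. by []. Qed.
Lemma ZmulE (a b : Z) : Z.mul a b = a * b. Proof. by []. Qed.
Lemma ZoppE (a : Z) : Z.opp a = - a. Proof. by []. Qed.
Definition ZE := (ZsubE, ZaddE, ZmulE, ZoppE).

Definition quad n (T : table) (c : nat -> Z) : Z :=
  \sum_(i < n) \sum_(j < n) c i * c j * get T i j.

Definition sym n (T : table) :=
  forall i j, (i < n)%N -> (j < n)%N -> get T i j = get T j i.

Lemma symbP n T : symb n T -> sym n T.
Proof.
move=> /allP h i j im jm; have /h/allP g : i \in iota 0 n by rewrite mem_iota.
by apply/Z.eqb_eq/g; rewrite mem_iota.
Qed.

Lemma quad_recl n T c : sym n.+1 T ->
  quad n.+1 T c = get T 0 0 * (c 0%N * c 0%N)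
    + (c 0%N * \sum_(j < n) c j.+1 * get T 0 j.+1) *+ 2
    + quad n (mk n (fun i j => get T i.+1 j.+1)) (fun i => c i.+1).
Proof.
move=> sT; rewrite /quad big_ord_recl [X in X + _]big_ord_recl.
under [X in _ + X]eq_bigr do rewrite big_ord_recl.
rewrite big_split /=; pose s := \sum_(j < n) c j.+1 * get T 0 j.+1.
have -> : \sum_(i < n) c 0%N * c (bump 0 i) * get T 0 (bump 0 i) = c 0%N * s.
  by rewrite mulr_sumr; apply: eq_bigr => i _; rewrite mulrA.
have -> : \sum_(i < n) c (bump 0 i) * c 0%N * get T (bump 0 i) 0 = c 0%N * s.
  by rewrite mulr_sumr; apply: eq_bigr => i _; rewrite -mulrA mulrCA (sT i.+1 0%N (ltn_ord i) isT).
rewrite -/s /quad.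
have -> : \sum_(i < n) \sum_(j < n) c i.+1 * c j.+1 * get (mk n (fun i j => get T i.+1 j.+1)) i j
   = \sum_(i < n) \sum_(j < n) c (bump 0 i) * c (bump 0 j) * get T (bump 0 i) (bump 0 j).
  by do 2 (apply: eq_bigr => ? _); rewrite get_mk.
by ring.
Qed.

Definition schur n T := mk n (fun i j =>
  Z.sub (Z.mul (get T 0 0) (get T i.+1 j.+1)) (Z.mul (get T 0 i.+1) (get T 0 j.+1))).

(** This is the remainder after completing the square in the first variable of the form scaled by
    its pivot. *)
Lemma quad_schur n T c :
  quad n (schur n T) c =
  get T 0 0 * quad n (mk n (fun i j => get T i.+1 j.+1)) c
  - (\sum_(j < n) c j * get T 0 j.+1) ^+ 2.
Proof.
rewrite expr2 big_distrlr /= /quad mulr_sumr -sumrB; apply: eq_bigr => i _.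
rewrite mulr_sumr -sumrB; apply: eq_bigr => j _.
by rewrite !get_mk // !ZE; ring.
Qed.

Lemma sym_schur n T : sym n.+1 T -> sym n (schur n T).
Proof. by move=> sT i j im jm; rewrite !get_mk // (sT i.+1) // [Z.mul (get T 0 i.+1) _]Z.mul_comm. Qed.

Lemma sym_tail n T : sym n.+1 T -> sym n (mk n (fun i j => get T i.+1 j.+1)).
Proof. by move=> sT i j im jm; rewrite !get_mk // sT. Qed.

Definition scons (a : Z) (c : nat -> Z) i := if i is i'.+1 then c i' else a.

(** The search prunes when [psdb] fails, so its soundness requires that no semidefinite form be
    rejected. *)
Lemma psdbP n T : sym n T -> (forall c, 0 <= quad n T c) -> psdb n T.
Proof.
elim: n T => //= n IH T sT qT.
have recl a c := quad_recl (scons a c) sT; rewrite /= in recl.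
have a_ge0 : 0 <= get T 0 0.
  have := qT (scons 1 (fun _ => 0)); rewrite recl /= big1 => [|i _]; last by rewrite mul0r.
  rewrite /quad big1 => [|i _]; last by rewrite big1 // => j _; rewrite !mul0r.
  by rewrite mulr0 mul0rn !addr0 !mulr1.
case: ifP => [a_gt0|a_le0].
  apply: IH; first exact: sym_schur.
  move=> c; rewrite -/(schur n T) quad_schur.
  set s := \sum_(j < n) _; set q := quad _ _ _; set a := get T 0 0.
  (* At [(- s, a c)] the form equals [a] times the Schur form at [c]. *)
  have := qT (scons (- s) (fun i => a * c i)); rewrite recl -/a /=.
  have -> : \sum_(j < n) a * c j * get T 0 j.+1 = a * s.
    by rewrite mulr_sumr; apply: eq_bigr => j _; rewrite mulrA.
  have -> : quad n (mk n (fun i j => get T i.+1 j.+1)) (fun i => a * c i) = a * (a * q).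
    rewrite /q /quad !mulr_sumr; apply: eq_bigr => i _; rewrite !mulr_sumr.
    by apply: eq_bigr => j _; ring.
  have -> : a * (- s * - s) + - s * (a * s) *+ 2 + a * (a * q) = a * (a * q - s ^+ 2) by ring.
  by rewrite pmulr_rge0 //; rewrite /a; lia.
have a0 : get T 0 0 = 0 by lia.
have b0 j : (j < n)%N -> get T 0 j.+1 = 0.
  move=> jn; apply: contraTeq isT => nz.
  pose b := get T 0 j.+1.
  (* At [t e_0 + e_j] the form is affine in [t] with slope [2 b]; a nonzero [b] makes it negative at
     the [t] chosen below. *)
  have h t : 0 <= t * b *+ 2 + get T j.+1 j.+1.
    have := qT (scons t (fun i => (i == j)%:R)); rewrite recl a0 mul0r add0r.
    rewrite (bigD1 (Ordinal jn)) //= eqxx mul1r big1 ?addr0; last first.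
      by move=> i; rewrite -val_eqE /= => /negbTE ->; rewrite mul0r.
    rewrite /quad (bigD1 (Ordinal jn)) //= eqxx (bigD1 (Ordinal jn)) //= eqxx.
    rewrite get_mk // !mul1r !big1 ?addr0 //.
      by move=> i; rewrite -val_eqE /= => /negbTE ->; rewrite big1 // => k _; rewrite !mul0r.
    by move=> i; rewrite -val_eqE /= => /negbTE ->; rewrite mulr0 mul0r.
  have := h (- b * (1 + get T j.+1 j.+1)); have := h 0.
  have : 1 <= b ^+ 2 by rewrite expr2; have : b != 0 := nz; nia.
  by rewrite expr2; nia.
rewrite a0 /=; case: ifP => [_|/negbT/allPn[j]]; last first.
  by rewrite mem_iota => jn; rewrite b0.
apply: IH; first exact: sym_tail.
move=> c; have := qT (scons 0 c); rewrite recl a0.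
by rewrite !mul0r mul0rn !add0r.
Qed.

Lemma pdbP n T c : sym n T -> pdb n T -> (exists2 i, (i < n)%N & c i != 0) ->
  0 < quad n T c.
Proof.
elim: n T c => [|n IH] T c sT /=; first by move=> _ [].
case: ifP => // a_gt0 pT nzc; rewrite quad_recl //.
set s := \sum_(j < n) _; set q := quad _ _ _; set a := get T 0 0.
have {}a_gt0 : 0 < a by rewrite /a; lia.
rewrite -(pmulr_rgt0 _ a_gt0).
(* If the tail of [c] is nonzero, the Schur term is positive by induction; otherwise [c 0] is
   nonzero and the square is positive. *)
have -> : a * (a * (c 0%N * c 0%N) + c 0%N * s *+ 2 + q) = (a * c 0%N + s) ^+ 2 + (a * q - s ^+ 2) by ring.
have := quad_schur n T (fun i => c i.+1); rewrite -/a -/q -/s => hq; rewrite -hq.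
case: (boolP (has (fun i => c i.+1 != 0) (iota 0 n))) => [/hasP[i]|/hasPn c0].
  rewrite mem_iota => im ci; apply: ltr_wpDl; first exact: sqr_ge0.
  by apply: IH => //; [exact: sym_schur | exists i].
have z i : (i < n)%N -> c i.+1 = 0.
  by move=> im; apply/eqP; rewrite -[_ == _]negbK; apply: c0; rewrite mem_iota.
have s0 : s = 0 by rewrite /s big1 // => i _; rewrite z ?mul0r.
rewrite s0 addr0 {1}/quad big1 ?addr0; last first.
  by move=> i _; rewrite big1 // => j _; rewrite z ?mul0r.
have c00 : c 0%N != 0 by case: nzc => [[|i] im ci] //; rewrite z ?eqxx in ci.
by rewrite exprn_even_gt0 //= mulf_eq0 negb_or c00 andbT gt_eqF.
Qed.

(** * Exhaustive search for the columns l_e *)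

Fixpoint all_tails (f : seq Z -> seq (seq Z) -> bool) s : bool :=
  if s is c :: s' then if f c s then all_tails f s' else false else true.

(* Columns are chosen in the order of [cs], repetitions allowed: reordering the
   orthonormal family loses nothing. *)
Fixpoint csearch (leaf : table -> seq (seq Z) -> bool) m k cs T cols : bool :=
  if k is k'.+1 then
    all_tails (fun c s => let T' := shrink m T c in
      if psdb m T' then csearch leaf m k' s T' (rcons cols c) else true) cs
  else leaf T cols.

Definition zrange (b : nat) : seq Z :=
  [seq Z.sub (Z.of_nat i) (Z.of_nat b) | i <- iota 0 (b + b).+1].
Fixpoint box (bs : seq nat) : seq (seq Z) :=
  if bs is b :: bs' then [seq x :: l | x <- zrange b, l <- box bs'] else [:: [::]].
(* The first nonzero entry is positive; replacing e by -e negates l_e. *)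
Fixpoint snorm (l : seq Z) : bool :=
  if l is x :: l' then if Z.eqb x Z0 then snorm l' else Z.ltb Z0 x else true.
Definition cands m (T : table) bs : seq (seq Z) :=
  [seq l <- box bs | if snorm l then psdb m (shrink m T l) else false].
(** By Cauchy-Schwarz the product of a unit vector with [x_i] has square at most the norm of [x_i],
    so norms below [(b_i + 1) ^ 2] confine the products to [box bs]. *)
Definition in_bounds m (T : table) (bs : seq nat) : bool :=
  (size bs == m) &&
  all (fun i => Z.ltb (get T i i) (Z.of_nat ((nth 0%N bs i).+1 * (nth 0%N bs i).+1)))
    (iota 0 m).

Lemma mem_zrange b (x : Z) : (x \in zrange b) = (- Z.of_nat b <= x <= Z.of_nat b).
Proof.
apply/mapP/idP => [[i]|h].
  by rewrite mem_iota => h ->; rewrite ZE; lia.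
by exists (Z.to_nat (x + Z.of_nat b)); rewrite ?mem_iota ?ZE; lia.
Qed.

Lemma mem_box bs (l : seq Z) : size l = size bs ->
  (forall i, (i < size bs)%N -> l`_i \in zrange (nth 0%N bs i)) -> l \in box bs.
Proof.
elim: bs l => [|b bs IH] [|x l] // [sl] h.
have -> : box (b :: bs) = [seq y :: r | y <- zrange b, r <- box bs] by [].
apply: (@allpairs_f _ _ _ cons); first exact: (h 0%N).
by apply: IH => // i; exact: (h i.+1).
Qed.

Lemma snormVN l : snorm l || snorm (map Z.opp l).
Proof.
elim: l => //= x l IH; case: Z.eqb_spec => [->|nx] //=.
by case: Z.eqb_spec => ?; lia.
Qed.

Lemma all_tailsP f s s1 c s2 : all_tails f s -> s = s1 ++ c :: s2 -> f c (c :: s2).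
Proof.
elim: s s1 => [|d s IH] [|e s1] //=; case: ifP => // fd at_s [].
- by move=> <- <-.
- by move=> _; exact: IH.
Qed.

(** These are the paths explored by [csearch]: each column comes from the suffix starting at its
    predecessor. *)
Fixpoint chain (C cols : seq (seq Z)) : Prop :=
  if cols is c :: cols' then exists s1 s2, C = s1 ++ c :: s2 /\ chain (c :: s2) cols'
  else True.

Lemma chain_sorted C cols : {subset cols <= C} ->
  sorted (relpre (index^~ C) leq) cols -> chain C cols.
Proof.
elim: cols C => //= c cols IH C sub pc.
have cC : c \in C by rewrite sub ?mem_head.
(* Cutting at the first occurrence of [c] keeps [c] in the suffix, so it may be repeated; later
   columns have index at least [i] and are not lost. *)
pose i := index c C; have iC : (i < size C)%N by rewrite index_mem.
have dE : drop i C = c :: drop i.+1 C by rewrite (drop_nth [::]) // nth_index.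
exists (take i C), (drop i.+1 C); rewrite -dE cat_take_drop; split=> //.
have le_i b : b \in cols -> (i <= index b C)%N.
  move=> bc; have tr : transitive (relpre (index^~ C) leq) by move=> ? ? ? /=; exact: leq_trans.
  by have /allP/(_ b bc) := order_path_min tr pc.
have nt b : b \in cols -> b \notin take i C.
  move=> bc; apply/negP => bt; have := le_i b bc; rewrite leqNgt -{1}(cat_take_drop i C).
  by rewrite index_cat bt -{2}(size_takel (ltnW iC)) index_mem bt.
apply: IH => [b bc|].
  have := sub b; rewrite inE bc orbT => /(_ isT).
  by rewrite -{1}(cat_take_drop i C) mem_cat (negbTE (nt b bc)).
apply: (@sub_in_sorted _ (mem cols) (relpre (index^~ C) leq)); last exact: path_sorted pc.
  move=> a b ac bc /=; rewrite -{1 2}(cat_take_drop i C) !index_cat.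
  by rewrite (negbTE (nt a ac)) (negbTE (nt b bc)) leq_add2l.
by apply/allP.
Qed.

Section Sound.
Variable L : zlattice.
Implicit Types (x y z e : L) (es xs ys : seq L).

Definition lam xs e : seq Z := [seq bz x e | x <- xs].

(** Under [onb es] the entries are the products of residuals. In this explicit form, adding a vector
    to [es] is a rank one subtraction. *)
Definition isres xs es (T : table) :=
  forall i j, (i < size xs)%N -> (j < size xs)%N ->
  get T i j = bz xs`_i xs`_j - \sum_(e <- es) bz xs`_i e * bz xs`_j e.

Lemma nth_lam xs e i : (i < size xs)%N -> (lam xs e)`_i = bz xs`_i e.
Proof. by move=> ix; rewrite (nth_map 0). Qed.

Lemma isres_res xs es T : onb es -> isres xs es T ->
  forall i j, (i < size xs)%N -> (j < size xs)%N ->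
  get T i j = bz (res es xs`_i) (res es xs`_j).
Proof. by move=> oe rT i j ix jx; rewrite rT // bz_res. Qed.

Lemma isres_psdb xs es T : onb es -> isres xs es T -> psdb (size xs) T.
Proof.
move=> oe /(isres_res oe) rT; apply: psdbP.
  by move=> i j ix jx; rewrite !rT // bzC.
move=> c; pose s : L := \sum_(i < size xs) sc (c i) (res es xs`_i).
suff -> : quad (size xs) T c = bz s s by exact: bz_ge0.
rewrite bz_suml; apply: eq_bigr => i _; rewrite bz_sumr; apply: eq_bigr => j _.
by rewrite rT // bzZl bzZr mulrA.
Qed.

Lemma shrink_isres xs es e T : isres xs es T ->
  isres xs (rcons es e) (shrink (size xs) T (lam xs e)).
Proof.
move=> rT i j ix jx; rewrite get_mk // !ZE !nth_lam // rT //.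
by rewrite big_rcons /=; ring.
Qed.

Lemma onb_catl es1 es2 : onb (es1 ++ es2) -> onb es1.
Proof.
case; rewrite cat_uniq => /andP[u1 _] o; split=> // x y x1 y1.
by apply: o; rewrite mem_cat ?x1 ?y1.
Qed.

Lemma onb_perm es1 es2 : perm_eq es1 es2 -> onb es1 -> onb es2.
Proof.
move=> p [u o]; split; first by rewrite -(perm_uniq p).
by move=> x y; rewrite -!(perm_mem p); exact: o.
Qed.

(** Every prefix of the family has a semidefinite residual Gram matrix, so the branch of the actual
    columns is never pruned and the test at its leaf has succeeded. *)
Lemma csearchP leaf xs es1 es2 C T :
  onb (es1 ++ es2) -> isres xs es1 T -> chain C (map (lam xs) es2) ->
  csearch leaf (size xs) (size es2) C T (map (lam xs) es1) ->
  exists2 T', isres xs (es1 ++ es2) T' & leaf T' (map (lam xs) (es1 ++ es2)).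
Proof.
elim: es2 es1 C T => [|e es2 IH] es1 C T /=.
  by rewrite cats0 => _ rT _ lT; exists T.
rewrite -cat_rcons => oe rT [s1 [s2 [Cs ch]]] h.
have := all_tailsP h Cs; have rT' := shrink_isres e rT.
rewrite (isres_psdb (onb_catl oe) rT') -map_rcons => h'.
exact: (IH _ _ _ oe rT' ch h').
Qed.

Lemma cands_complete xs T bs e : isres xs [::] T -> in_bounds (size xs) T bs ->
  bz e e = 1 -> lam xs e \in cands (size xs) T bs \/ lam xs (- e) \in cands (size xs) T bs.
Proof.
move=> rT /andP[/eqP sb /allP bd] e1.
have one f : bz f f = 1 -> snorm (lam xs f) -> lam xs f \in cands (size xs) T bs.
  move=> f1 sn; have of1 : onb [:: f].
    by split=> // x y; rewrite !inE => /eqP-> /eqP->; rewrite eqxx.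
  have rf := shrink_isres f rT; rewrite mem_filter sn (isres_psdb of1 rf) /=.
  apply: mem_box => [|i]; rewrite ?size_map // sb => ix; rewrite nth_lam // mem_zrange.
  have := bz_ge0 (res [:: f] xs`_i); rewrite -(isres_res of1 rf) // rf // big_seq1.
  have := bd i; rewrite mem_iota rT // big_nil subr0 => /(_ ix).
  set b := nth 0%N bs i; set t := bz xs`_i xs`_i; set l := bz xs`_i f.
  by move=> *; have : (l < Z.of_nat b.+1) && (- l < Z.of_nat b.+1); nia.
have -> : lam xs (- e) = map Z.opp (lam xs e).
  by rewrite -map_comp; apply: eq_map => x /=; rewrite bzNr.
case/orP: (snormVN (lam xs e)) => sn; [left|right]; first exact: one.
have -> : map Z.opp (lam xs e) = lam xs (- e).
  by rewrite -map_comp; apply: eq_map => x /=; rewrite bzNr.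
apply: one; first by rewrite bzNl bzNr opprK.
by rewrite /lam; under eq_map do rewrite bzNr; rewrite map_comp.
Qed.

Lemma onb_signs es (f : L -> L) : onb es -> (forall e, f e = e \/ f e = - e) ->
  onb (map f es).
Proof.
case=> ue oe hf.
have bzf x y : x \in es -> y \in es -> x != y -> bz (f x) (f y) = 0.
  move=> xe ye /negbTE nxy; have := oe x y xe ye; rewrite nxy => b0.
  by case: (hf x) (hf y) => [] -> [] ->; rewrite ?bzNl ?bzNr b0 ?oppr0.
have bzf1 x : x \in es -> bz (f x) (f x) = 1.
  by move=> xe; case: (hf x) => ->; rewrite ?bzNl ?bzNr ?opprK oe // eqxx.
have injf : {in es &, injective f}.
  move=> x y xe ye fxy; apply: contraTeq isT => nxy.
  by have := bzf1 x xe; rewrite {2}fxy bzf.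
split; first by rewrite map_inj_in_uniq.
move=> x' y' /mapP[x xe ->{x'}] /mapP[y ye ->{y'}]; rewrite (inj_in_eq injf) //.
by case: eqVneq => [->|]; [exact: bzf1 | exact: bzf].
Qed.

(** Signs are changed so that every column is a candidate, and the family is sorted by candidate
    index; both operations keep it orthonormal. *)
Lemma search_sound leaf xs T bs es :
  onb es -> isres xs [::] T -> in_bounds (size xs) T bs ->
  csearch leaf (size xs) (size es) (cands (size xs) T bs) T [::] ->
  exists es' T', [/\ onb es', size es' = size es, isres xs es' T' &
    leaf T' (map (lam xs) es')].
Proof.
move=> oe rT bd; set C := cands _ _ _ => h.
pose f e := if lam xs e \in C then e else - e.
have hf e : f e = e \/ f e = - e by rewrite /f; case: ifP; auto.
have fC e : e \in es -> lam xs (f e) \in C.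
  move=> ee; rewrite /f; case: ifP => // nC.
  have e1 : bz e e = 1 by case: oe => _ /(_ e e ee ee) ->; rewrite eqxx.
  by case: (cands_complete rT bd e1) => //; rewrite -/C nC.
pose r := relpre (fun e => index (lam xs e) C) leq.
pose es2 := sort r (map f es).
have p : perm_eq es2 (map f es) by rewrite perm_sort.
have oe2 : onb es2 by apply: onb_perm (onb_signs oe hf); rewrite perm_sym.
have s2 : size es2 = size es by rewrite (perm_size p) size_map.
have [||T' rT' lT'] := @csearchP leaf xs [::] es2 C T oe2 rT.
- apply: chain_sorted.
    by move=> c /mapP[e]; rewrite (perm_mem p) => /mapP[e0 /fC ? ->] ->.
  by rewrite sorted_map; apply: sort_sorted => x y; exact: leq_total.
- by rewrite s2.
by exists es2, T'.
Qed.

End Sound.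

(** * Tests at the leaves of the search *)

(* At a leaf, [R] is the Gram matrix of the residuals and the rank of [R] is at
   most 1 or 2. A leaf test returning [true] means that the leaf is either
   impossible in that rank or (for [leaf_unit]) has the desired property. *)
Definition minor2 (R : table) i j :=
  Z.sub (Z.mul (get R i i) (get R j j)) (Z.mul (get R i j) (get R i j)).
Definition minor3 (R : table) i j k :=
  Z.add (Z.sub (Z.mul (get R i i) (minor2 R j k))
    (Z.mul (get R i j)
       (Z.sub (Z.mul (get R i j) (get R k k)) (Z.mul (get R j k) (get R i k)))))
    (Z.mul (get R i k)
       (Z.sub (Z.mul (get R i j) (get R j k)) (Z.mul (get R j j) (get R i k)))).

Definition pairs m : seq (nat * nat) :=
  [seq p <- [seq (i, j) | i <- iota 0 m, j <- iota 0 m] | (p.1 < p.2)%N].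
Definition triples m : seq (nat * (nat * nat)) :=
  [seq (i, p) | i <- iota 0 m, p <- pairs m].

Fixpoint dot (u v : seq Z) : Z :=
  match u, v with a :: u', b :: v' => Z.add (Z.mul a b) (dot u' v') | _, _ => Z0 end.

Fixpoint ball k (n : nat) : seq (seq Z) :=
  if k is k'.+1 then
    flatten [seq [seq x :: l | l <- ball k' (n - Z.to_nat (x * x))]
           | x <- zrange n & Z.leb (x * x) (Z.of_nat n)]
  else [:: [::]].

(* The bilinear form of the adjugate of the (i, j) principal minor of [R]. *)
Definition adj2 (R : table) i j (c c' : Z * Z) :=
  Z.add (Z.sub (Z.mul (get R j j) (Z.mul c.1 c'.1))
               (Z.mul (get R i j) (Z.add (Z.mul c.1 c'.2) (Z.mul c.2 c'.1))))
        (Z.mul (get R i i) (Z.mul c.2 c'.2)).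

Definition col_row (cols : seq (seq Z)) i : seq Z := [seq nth Z0 c i | c <- cols].

Definition big_rank m R :=
  has (fun t => ~~ Z.eqb (minor3 R t.1 t.2.1 t.2.2) Z0) (triples m).

Definition pivots m R := [seq p <- pairs m | ~~ Z.eqb (minor2 R p.1 p.2) Z0].

Definition leaf_rank2 m (R : table) (_ : seq (seq Z)) : bool :=
  if pivots m R is [::] then false else true.

(* Some small integral combination of the residuals has norm 1. *)
Definition leaf_unit m (R : table) (_ : seq (seq Z)) :=
  if big_rank m R then true else
  has (fun c => Z.eqb
         (dot c [seq dot c [seq get R i j | j <- iota 0 m] | i <- iota 0 m]) 1)
      (box (nseq m 1%N)).

(* No vector w of norm n is orthogonal to all the represented vectors: [u] ranges
   over the possible coordinates of w, and [s] is the norm left to its residual. *)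
Definition leaf_orth m (us : seq (seq Z * Z)) (R : table) (cols : seq (seq Z)) :=
  if big_rank m R then true else
  if pivots m R is (i, j) :: _ then
    let d := minor2 R i j in
    let ui := col_row cols i in let uj := col_row cols j in
    let Rii := get R i i in
    let rows := [seq (col_row cols k, (get R k i, get R k j)) | k <- iota 0 m] in
    all (fun us => let: (u, s) := (us : seq Z * Z) in
      let a := dot u ui in
      if Z.ltb (Z.mul s Rii) (Z.mul a a) then true else
      let c := (Z.opp a, Z.opp (dot u uj)) in
      if Z.eqb (Z.mul d s) (adj2 R i j c c) then
        has (fun r => ~~ Z.eqb (Z.add (Z.mul d (dot u r.1)) (adj2 R i j c r.2)) Z0) rows
      else true) us
  else false.

Definition ball_slack k n := [seq (u, Z.sub (Z.of_nat n) (dot u u)) | u <- ball k n].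

(** Backtracking over one vector from each list, with [ps] the vectors already chosen. In a pair,
    the first component holds coordinates and the second the functional applied to later vectors. *)
Fixpoint no_orth (css : seq (seq (seq Z * seq Z))) (ps : seq (seq Z * seq Z)) : bool :=
  if css is cs :: css' then
    all (fun z => no_orth css' (z :: ps))
      [seq z <- cs | all (fun p => Z.eqb (dot p.2 z.1) Z0) ps]
  else false.

Definition flat (v : seq Z) (c : Z * Z) : seq Z := v ++ [:: c.1; c.2].
Definition adj_row d (R : table) i j (v : seq Z) (c : Z * Z) : seq Z :=
  [seq Z.mul d x | x <- v] ++
  [:: Z.sub (Z.mul (get R j j) c.1) (Z.mul (get R i j) c.2);
      Z.sub (Z.mul (get R i i) c.2) (Z.mul (get R i j) c.1)].

(* No pairwise orthogonal vectors have the norms [ns]: a vector z is encoded by its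
   products with the orthonormal family and with the residuals i and j, and
   [adj_row] by [flat] gives the determinant d times the form. *)
Definition leaf_diag m k ns bd (R : table) (cols : seq (seq Z)) :=
  if big_rank m R then true else
  if pivots m R is (i, j) :: _ then
    let d := minor2 R i j in
    let small n := Z.leb (Z.mul (Z.of_nat n) (get R i i)) (Z.of_nat (bd * bd))
               && Z.leb (Z.mul (Z.of_nat n) (get R j j)) (Z.of_nat (bd * bd)) in
    let rs := [seq (get R l i, get R l j) | l <- iota 0 m] in
    let cs := [seq c <- [seq (a, b) | a <- zrange bd, b <- zrange bd] |
      all (fun r => Z.eqb (Z.modulo (adj2 R i j c r) d) Z0) rs] in
    let cand n := flatten [seq
        let s := Z.mul d (Z.sub (Z.of_nat n) (dot v v)) in
        [seq (flat v c, adj_row d R i j v c) |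
           c <- cs & if Z.eqb s (adj2 R i j c c) then snorm (flat v c) else false]
      | v <- ball k n] in
    all small ns && no_orth [seq cand n | n <- ns] [::]
  else false.

(* Test lattices found by computer search. *)
Definition T_245 : table :=
  [:: [:: 4; 2; -1; 0]; [:: 2; 4; -1; -1]; [:: -1; -1; 5; -1]; [:: 0; -1; -1; 5]].
Definition T_75 : table := [:: [:: 4; -1; 0]; [:: -1; 4; 0]; [:: 0; 0; 5]].
Definition T_A4 : table :=
  [:: [:: 2; -1; 0; 0]; [:: -1; 2; -1; 0]; [:: 0; -1; 2; -1]; [:: 0; 0; -1; 2]].
Definition T_133 : table := [:: [:: 1; 0; 0]; [:: 0; 3; 0]; [:: 0; 0; 3]].
Definition T_1133 : table :=
  [:: [:: 1; 0; 0; 0]; [:: 0; 1; 0; 0]; [:: 0; 0; 3; 0]; [:: 0; 0; 0; 3]].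

Lemma search_133 :
  csearch (leaf_rank2 3) 3 3 (cands 3 T_133 [:: 1; 1; 1]%N) T_133 [::].
Proof. by vm_cast_no_check (erefl true). Qed.
Lemma search_1133 :
  csearch (leaf_rank2 4) 4 4 (cands 4 T_1133 [:: 1; 1; 1; 1]%N) T_1133 [::].
Proof. by vm_cast_no_check (erefl true). Qed.
(** Splitting four unit vectors off [A_4] leaves either residuals of rank at least 3 or a further
    unit vector, which supplies the fifth one for the next search. *)
Lemma search_A4 :
  csearch (leaf_unit 4) 4 4 (cands 4 T_A4 [:: 1; 1; 1; 1]%N) T_A4 [::].
Proof. by vm_cast_no_check (erefl true). Qed.
Lemma search_245 :
  csearch (leaf_rank2 4) 4 5 (cands 4 T_245 [:: 2; 2; 2; 2]%N) T_245 [::].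
Proof. by vm_cast_no_check (erefl true). Qed.
Lemma search_245_15 :
  let us := ball_slack 5 15 in
  csearch (leaf_orth 4 us) 4 5 (cands 4 T_245 [:: 2; 2; 2; 2]%N) T_245 [::].
Proof. by vm_cast_no_check (erefl true). Qed.
(** The bound 6 suffices: a vector of norm at most 7 and a residual of norm at most 5 have a product
    of square at most 35. *)
Lemma search_75_377 :
  csearch (leaf_diag 3 3 [:: 3; 7; 7]%N 6) 3 3 (cands 3 T_75 [:: 2; 2; 2]%N) T_75 [::].
Proof. by vm_cast_no_check (erefl true). Qed.

(** * Correctness of the leaf tests *)

Lemma mem_pairs m p : p \in pairs m -> (p.1 < m)%N /\ (p.2 < m)%N.
Proof.
rewrite mem_filter => /andP[_ /allpairsP[q [q1 q2 ->]]] /=.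
by move: q1 q2; rewrite !mem_iota.
Qed.

Lemma size_box bs c : c \in box bs -> size c = size bs.
Proof.
elim: bs c => [|b bs IH] c; first by rewrite inE => /eqP ->.
have -> : box (b :: bs) = [seq y :: r | y <- zrange b, r <- box bs] by [].
by case/allpairsP => p [_ /IH + ->] => /= ->.
Qed.

(** An actual orthogonal family is a branch of the backtracking that survives to the last list. *)
Lemma no_orthP (T : eqType) css ps (zs : seq T) (F : T -> seq Z * seq Z) :
  all2 (fun z cs => F z \in cs) zs css ->
  {in ps & zs, forall p z, dot p.2 (F z).1 = 0} ->
  pairwise (fun z z' => dot (F z).2 (F z').1 == 0) zs -> no_orth css ps = false.
Proof.
elim: zs css ps => [|z zs IH] [|cs css] ps //= /andP[zc zsc] ops /andP[oz pz].
apply/negbTE/allPn; exists (F z).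
  rewrite mem_filter zc andbT; apply/allP => p pp; apply/Z.eqb_eq.
  by rewrite ops ?mem_head.
rewrite (IH css) // => p x; rewrite inE => /orP[/eqP ->|pp] xz.
  by have /allP/(_ x xz)/eqP := oz.
by apply: ops; rewrite // inE xz orbT.
Qed.

Lemma dot_ge0 u : 0 <= dot u u.
Proof. by elim: u => //= a u IH; rewrite !ZE addr_ge0 // -expr2 sqr_ge0. Qed.

Lemma dot_cat u u' v v' : size u = size v -> dot (u ++ u') (v ++ v') = dot u v + dot u' v'.
Proof.
elim: u v => [|a u IH] [|b v] //=.
by case=> /IH ->; rewrite !ZE addrA.
Qed.

Lemma dot_map (I : Type) (s : seq I) (F G : I -> Z) :
  dot [seq F i | i <- s] [seq G i | i <- s] = \sum_(i <- s) F i * G i.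
Proof. by elim: s => [|a s IH] /=; rewrite ?big_nil // big_cons IH. Qed.

Lemma mem_ball (l : seq Z) n : dot l l <= Z.of_nat n -> l \in ball (size l) n.
Proof.
elim: l n => [|x l IH] n // h.
have {}h : x * x + dot l l <= Z.of_nat n by [].
have l0 := dot_ge0 l.
have -> : ball (size (x :: l)) n =
    flatten [seq [seq y :: r | r <- ball (size l) (n - Z.to_nat (y * y))]
            | y <- zrange n & Z.leb (y * y) (Z.of_nat n)] by [].
apply/flatten_mapP; exists x; first by rewrite mem_filter mem_zrange; nia.
by apply: map_f; apply: IH; nia.
Qed.

Lemma det2E (A : 'M[Z]_2) : \det A = A 0 0 * A 1 1 - A 0 1 * A 1 0.
Proof.
rewrite (expand_det_row _ ord0) !big_ord_recl big_ord0 /cofactor !det_mx11 !mxE /=.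
rewrite expr0 expr1 mul1r mulN1r mulrN addr0.
by congr (A _ _ * A _ _ - A _ _ * A _ _); apply: val_inj.
Qed.

Section Leaves.
Variable L : zlattice.
Implicit Types (x y z e w : L) (es xs ys : seq L).

Lemma cauchy x y : bz x y * bz x y <= bz x x * bz y y.
Proof.
have := bz_ge0 (sc (bz y y) x - sc (bz x y) y).
rewrite !(bzDl, bzDr, bzNl, bzNr, bzZl, bzZr) (bzC y x).
set X := bz x x; set Y := bz y y; set c := bz x y => h.
have [/bz_eq0 y0|Y0] := eqVneq Y 0; first by rewrite /c /Y y0 !bz0r !mulr0.
have : 0 < Y by rewrite lt_neqAle eq_sym Y0 bz_ge0.
move=> Yp; rewrite -subr_ge0 -(pmulr_rge0 _ Yp).
by apply: le_trans h _; rewrite le_eqVlt; apply/orP; left; apply/eqP; ring.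
Qed.

Lemma gram2_eq0 es y1 y2 : onb es -> (dim L < size es + 2)%N ->
  {in [:: y1; y2] & es, forall y e, bz y e = 0} ->
  bz y1 y1 * bz y2 y2 - bz y1 y2 * bz y1 y2 = 0.
Proof.
move=> oe d o; rewrite -[RHS](gram_det0 (ys := [:: y1; y2]) oe d o) det2E !mxE /=.
by rewrite (bzC y2 y1).
Qed.

Lemma gram3_eq0 es y1 y2 y3 : onb es -> (dim L < size es + 3)%N ->
  {in [:: y1; y2; y3] & es, forall y e, bz y e = 0} ->
  bz y1 y1 * (bz y2 y2 * bz y3 y3 - bz y2 y3 * bz y2 y3)
  - bz y1 y2 * (bz y1 y2 * bz y3 y3 - bz y2 y3 * bz y1 y3)
  + bz y1 y3 * (bz y1 y2 * bz y2 y3 - bz y2 y2 * bz y1 y3) = 0.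
Proof.
move=> oe d o; rewrite -[RHS](gram_det0 (ys := [:: y1; y2; y3]) oe d o).
rewrite (expand_det_row _ ord0) !big_ord_recl big_ord0 /cofactor !det2E !mxE /=.
by rewrite !(bzC y2 y1) !(bzC y3) /bump /=; ring.
Qed.

Section Residual.
Variables (es xs : seq L) (R : table).
Hypotheses (oe : onb es) (rR : isres xs es R).
Let m := size xs.
Let y i := res es xs`_i.
Let cols := map (lam xs) es.

Lemma residual_orth i e : e \in es -> bz (y i) e = 0.
Proof. exact: res_orth. Qed.

Lemma get_residual i j : (i < m)%N -> (j < m)%N -> get R i j = bz (y i) (y j).
Proof. exact: isres_res. Qed.

Lemma minor2_eq0 i j : (dim L < size es + 2)%N -> (i < m)%N -> (j < m)%N ->
  minor2 R i j = 0.
Proof.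
move=> d im jm; rewrite /minor2 !get_residual // !ZE; apply: (gram2_eq0 oe d).
by move=> z e; rewrite !inE => /orP[] /eqP -> ee; rewrite residual_orth.
Qed.

Lemma big_rankF : (dim L < size es + 3)%N -> big_rank m R = false.
Proof.
move=> d; apply/hasPn => t /allpairsP[[i [j k]] [/= ii /mem_pairs /= [jm km] ->]] /=.
have {}im : (i < m)%N by rewrite mem_iota in ii.
rewrite negbK /minor3 /minor2 !get_residual // !ZE; apply/Z.eqb_eq/(gram3_eq0 oe d).
by move=> z e; rewrite !inE => /or3P[] /eqP -> ee; rewrite residual_orth.
Qed.

Lemma leaf_rank2F : (dim L < size es + 2)%N -> leaf_rank2 m R cols = false.
Proof.
move=> d; rewrite /leaf_rank2; case E: (pivots m R) => [//|p s].
have : p \in pivots m R by rewrite E mem_head.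
by rewrite mem_filter => /andP[+ /mem_pairs[im jm]]; rewrite minor2_eq0.
Qed.

(* In rank [size es + 2], an orthonormal family and two independent residuals
   span rationally, so they give coordinates for the whole form. *)
Lemma coord_formula i j z z' : (dim L < size es + 3)%N -> (i < m)%N -> (j < m)%N ->
  minor2 R i j != 0 ->
  minor2 R i j * bz z z' = minor2 R i j * (\sum_(e <- es) bz z e * bz z' e)
    + adj2 R i j (bz z (y i), bz z (y j)) (bz z' (y i), bz z' (y j)).
Proof.
move=> d im jm; rewrite /minor2 /adj2 !get_residual // !ZE /=.
set A := bz (y i) (y i); set B := bz (y j) (y j); set C := bz (y i) (y j).
set c1 := bz z (y i); set c2 := bz z (y j) => d0.
(* Up to the factor [A * B - C * C], [w] is the part of the residual of [z] orthogonal to residuals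
   [i] and [j]; the Gram determinant of the three then forces it to vanish. *)
pose w : L := sc (A * B - C * C) (res es z) - sc (B * c1 - C * c2) (y i)
  - sc (A * c2 - C * c1) (y j).
have yres k : bz (res es z) (y k) = bz z (y k).
  by rewrite bz_res_orth // => e ee; rewrite bzC residual_orth.
have wE v : bz w v = (A * B - C * C) * bz (res es z) v
    - (B * c1 - C * c2) * bz (y i) v - (A * c2 - C * c1) * bz (y j) v.
  by rewrite /w !(bzDl, bzNl, bzZl).
have wi : bz w (y i) = 0.
  rewrite wE yres -/c1 -/A (bzC (y j)) -/C; ring.
have wj : bz w (y j) = 0.
  by rewrite wE yres -/c2 -/B -/C; ring.
have we e : e \in es -> bz w e = 0.
  by move=> ee; rewrite wE res_orth // !residual_orth // !mulr0 !subr0.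
have w0 : w = 0.
  apply: bz_eq0; apply/eqP; have := gram3_eq0 (y1 := y i) (y2 := y j) (y3 := w) oe d.
  rewrite (bzC (y i) w) (bzC (y j) w) wi wj -/A -/B -/C => h.
  suff : (A * B - C * C) * bz w w == 0 by rewrite mulf_eq0 (negbTE d0).
  apply/eqP; rewrite -[RHS]h; first by ring.
  by move=> v e; rewrite !inE => /or3P[] /eqP -> ee; rewrite ?residual_orth ?we.
have := wE z'; rewrite w0 bz0l.
have -> : bz (res es z) z' = bz z z' - \sum_(e <- es) bz z e * bz z' e.
  rewrite /res bzDl bzNl bz_suml; congr (_ - _); apply: eq_bigr => e _.
  by rewrite bzZl (bzC e).
rewrite (bzC (y i) z') (bzC (y j) z') => h.
by apply/eqP; rewrite -subr_eq0; apply/eqP; rewrite [RHS]h; ring.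
Qed.

Lemma leaf_unitP : (dim L < size es + 3)%N -> leaf_unit m R cols ->
  exists2 f, bz f f = 1 & {in es, forall e, bz f e = 0}.
Proof.
move=> d; rewrite /leaf_unit big_rankF // => /hasP[c /size_box]; rewrite size_nseq => sz_c.
have cE : c = mkseq (nth Z0 c) m by rewrite -sz_c mkseq_nth.
move=> /Z.eqb_eq h; exists (\sum_(i <- iota 0 m) sc c`_i (y i)).
  rewrite -[RHS]h [X in dot X _]cE dot_map bz_suml big_seq [RHS]big_seq.
  apply: eq_bigr => i; rewrite mem_iota => im; rewrite bzZl; congr (_ * _).
  rewrite [X in dot X _]cE dot_map bz_sumr big_seq [RHS]big_seq.
  by apply: eq_bigr => j; rewrite mem_iota => jm; rewrite bzZr get_residual.
move=> e ee; rewrite bz_suml big1 // => i _; by rewrite bzZl residual_orth // mulr0.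
Qed.

Lemma col_rowE i : (i < m)%N -> col_row cols i = [seq bz xs`_i e | e <- es].
Proof. by move=> im; rewrite /col_row -map_comp; apply: eq_map => e /=; rewrite nth_lam. Qed.

Lemma bz_y z i : bz z (y i) = bz z xs`_i - \sum_(e <- es) bz z e * bz xs`_i e.
Proof.
rewrite bzC /y /res bzDl bzNl bz_suml bzC; congr (_ - _); apply: eq_bigr => e _.
by rewrite bzZl (bzC e) mulrC.
Qed.

(** The coordinates of an actual [w] occur in the enumeration and escape every test that would
    discard them. *)
Lemma leaf_orthF n w : (dim L < size es + 3)%N ->
  (forall i, (i < m)%N -> bz w xs`_i = 0) -> bz w w = Z.of_nat n ->
  leaf_orth m (ball_slack (size es) n) R cols = false.
Proof.
move=> d ow ww; apply/negbTE/negP; rewrite /leaf_orth big_rankF //.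
case E: (pivots m R) => [//|[i j] ps].
have : (i, j) \in pivots m R by rewrite E mem_head.
rewrite mem_filter /= => /andP[d0 /mem_pairs[/= im jm]].
have {}d0 : minor2 R i j != 0 by apply: contraNneq d0 => ->.
pose u := [seq bz w e | e <- es].
have uu : dot u u = \sum_(e <- es) bz w e * bz w e by rewrite dot_map.
have su : bz (res es w) (res es w) = Z.of_nat n - dot u u by rewrite bz_res // ww uu.
have du k : (k < m)%N -> dot u (col_row cols k) = \sum_(e <- es) bz w e * bz xs`_k e.
  by move=> km; rewrite col_rowE // dot_map.
have wy k : (k < m)%N -> bz w (y k) = - dot u (col_row cols k).
  by move=> km; rewrite bz_y ow // sub0r du.
move=> /allP/(_ (u, Z.of_nat n - dot u u)).
have ub : (u, Z.of_nat n - dot u u) \in ball_slack (size es) n.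
  apply: (map_f (fun u => (u, Z.sub (Z.of_nat n) (dot u u)))).
  by rewrite -(size_map (bz w) es); apply: mem_ball; rewrite -subr_ge0 -su bz_ge0.
move=> /(_ ub).
(* Cauchy-Schwarz for the residual of [w] and residual [i]. *)
have -> : Z.ltb (Z.mul (Z.of_nat n - dot u u) (get R i i))
    (Z.mul (dot u (col_row cols i)) (dot u (col_row cols i))) = false.
  have := cauchy (res es w) (y i); rewrite su get_residual // !ZE.
  have -> : bz (res es w) (y i) = - dot u (col_row cols i).
    by rewrite bz_res_orth ?wy // => e ee; rewrite bzC residual_orth.
  by set D := bz (y i) (y i); lia.
have F := coord_formula w _ d im jm d0.
(* The formula at [(w, w)] gives the norm equation; at [(w, x_k)], below, it shows that no row rules
   [w] out. *)
have := F w; rewrite ww -uu !wy // => Fw.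
rewrite !ZoppE; case: ifP => [_|]; last first.
  move/Z.eqb_spec => h; case: h; rewrite !ZE mulrBr Fw.
  by rewrite [_ + adj2 _ _ _ _ _]addrC addrK.
case/hasP => r /mapP[k]; rewrite mem_iota => km -> /=.
have := F xs`_k; rewrite ow // mulr0 -du // !wy // => Fk; rewrite !get_residual // !ZE.
have -> : (bz (y k) (y i), bz (y k) (y j)) = (bz xs`_k (y i), bz xs`_k (y j)).
  by congr (_, _); rewrite bz_res_orth // => e ee; rewrite bzC residual_orth.
by rewrite -Fk.
Qed.

Lemma leaf_diagF ns bd zs : (dim L < size es + 3)%N -> size zs = size ns ->
  (forall k, (k < size ns)%N -> bz zs`_k zs`_k = Z.of_nat (nth 0%N ns k)) ->
  pairwise (fun z z' => bz z z' == 0) zs ->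
  leaf_diag m (size es) ns bd R cols = false.
Proof.
move=> d szs nzs ozs; apply/negbTE/negP; rewrite /leaf_diag big_rankF //.
case E: (pivots m R) => [//|[i j] ps].
have : (i, j) \in pivots m R by rewrite E mem_head.
rewrite mem_filter => /andP[d0 /mem_pairs[im jm]]; rewrite [_.1]/= [_.2]/= in d0 im jm.
have {}d0 : minor2 R i j != 0 by apply: contraNneq d0 => ->.
set rs := [seq _ | l <- iota 0 m]; set cs := [seq _ <- _ | _]; set cand := fun n : nat => flatten _.
case/andP => /allP sm.
pose C z := (bz z (y i), bz z (y j)).
pose V z := [seq bz z e | e <- es].
pose p z := (flat (V z) (C z), adj_row (minor2 R i j) R i j (V z) (C z)).
(* Sign changes preserve norms and orthogonality, so each vector may be normalized as the candidate
   lists require. *)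
pose s z := if snorm (flat (V z) (C z)) then z else - z.
have F := coord_formula _ _ d im jm d0.
have adjE c c' : adj2 R i j c c' =
    (get R j j * c.1 - get R i j * c.2) * c'.1 + (get R i i * c.2 - get R i j * c.1) * c'.2.
  by rewrite /adj2 !ZE; ring.
have ipE z z' : dot (p z).2 (p z').1 = minor2 R i j * bz z z'.
  rewrite F /= /adj_row /flat dot_cat ?size_map // adjE /= !ZE; congr (_ + _).
    rewrite mulr_sumr -map_comp dot_map; apply: eq_bigr => e _ /=; by rewrite !ZE mulrA.
  by rewrite [X in _ + X](_ : _ = (get R i i * (C z).2 - get R i j * (C z).1) * (C z').2 + 0) ?addr0.
have sE z : s z = z \/ s z = - z by rewrite /s; case: ifP; auto.
have snorm_s z : snorm (flat (V (s z)) (C (s z))).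
  rewrite /s; case: ifP => // nz; have := snormVN (flat (V z) (C z)); rewrite nz /=.
  congr (is_true (snorm _)); rewrite /flat map_cat -map_comp /= !bzNl; congr (_ ++ _).
  by apply: eq_map => e /=; rewrite bzNl.
have yz k z : (k < m)%N -> (get R k i, get R k j) = (bz xs`_k (y i), bz xs`_k (y j)).
  by move=> km; rewrite !get_residual //; congr (_, _); rewrite bz_res_orth // => e ee; rewrite bzC residual_orth.
have candP z n : n \in ns -> bz z z = Z.of_nat n -> p z \in cand n \/ ~~ snorm (flat (V z) (C z)).
  move=> nn zz; case: (boolP (snorm _)) => sz; last by right.
  left; apply/flatten_mapP; exists (V z).
    rewrite -(size_map (bz z) es); apply: mem_ball; rewrite dot_map -zz -subr_ge0.
    by rewrite -bz_res // bz_ge0.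
  have Fz := F z z; rewrite zz in Fz.
  apply: (map_f (fun c => (flat (V z) c, adj_row (minor2 R i j) R i j (V z) c))).
  rewrite mem_filter sz.
  have -> : Z.eqb (Z.mul (minor2 R i j) (Z.sub (Z.of_nat n) (dot (V z) (V z))))
      (adj2 R i j (C z) (C z)).
    by apply/Z.eqb_eq; rewrite !ZE mulrBr Fz dot_map [_ + adj2 _ _ _ _ _]addrC addrK.
  rewrite /= mem_filter; apply/andP; split.
    (* Residuals are lattice vectors: the adjugate value is the minor times the integral product of
       [z] with residual [l], whence divisibility. *)
    apply/allP => r /mapP[l]; rewrite mem_iota => lm ->; apply/Z.eqb_eq.
    have := F z (y l); rewrite big_seq big1 => [|e ee]; last by rewrite residual_orth ?mulr0.
    rewrite mulr0 add0r -!get_residual // => <-.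
    by rewrite -ZmulE Z.mul_comm Z.mod_mul //; apply/eqP.
  (* Cauchy-Schwarz and the test [small] bound both products by [bd]. *)
  have := sm n nn; move=> /andP[/Z.leb_le s1 /Z.leb_le s2].
  have b1 := cauchy z (y i); have b2 := cauchy z (y j); rewrite zz -!get_residual // in b1 b2.
  have [b1' b2'] : - Z.of_nat bd <= bz z (y i) <= Z.of_nat bd /\ - Z.of_nat bd <= bz z (y j) <= Z.of_nat bd.
    rewrite !ZE in s1 s2; move: s1 s2 b1 b2; set a := bz z (y i); set b := bz z (y j).
    by split; nia.
  by apply: (@allpairs_f _ _ _ (fun a b => (a, b))); rewrite mem_zrange.
rewrite (@no_orthP L [seq cand n | n <- ns] [::] zs (fun z => p (s z))) //.
- rewrite all2E size_map szs eqxx /=; apply/(all_nthP (0, [::])) => k; rewrite size_zip size_map szs minnn => kn.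
  rewrite nth_zip ?size_map // (nth_map 0%N) //=.
  have nn : nth 0%N ns k \in ns by rewrite mem_nth.
  case: (candP (s zs`_k) _ nn) => //; last by rewrite snorm_s.
  by case: (sE zs`_k) => ->; rewrite ?bzNl ?bzNr ?opprK nzs.
- apply: sub_pairwise ozs => z z' /eqP zz'; rewrite ipE.
  by case: (sE z) (sE z') => -> [] ->; rewrite ?bzNl ?bzNr zz' ?oppr0 mulr0.
Qed.

End Residual.
End Leaves.

(** * Lattices with a given Gram matrix, sums and padding *)

Definition table_form m (T : table) (x y : 'rV[int]_m) : int :=
  \sum_i \sum_j x 0 i * y 0 j * int_of_Z (get T i j).

Lemma table_form_bilinear m T :
  bilinear_for *%R (idfun \; *%R) (@table_form m T).
Proof.
split=> u a x y; rewrite /table_form /= mulr_sumr -big_split; apply: eq_bigr => i _ /=;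
  by rewrite mulr_sumr -big_split; apply: eq_bigr => j _ /=; rewrite !mxE; ring.
Qed.

HB.instance Definition _ m T := bilinear_isBilinear.Build int 'rV[int]_m 'rV[int]_m int
  *%R (idfun \; *%R) (@table_form m T) (table_form_bilinear m T).

Lemma lattice_of_table m T : symb m T -> pdb m T ->
  exists2 l : zlattice, zrank l = m & exists2 xs : seq l, size xs = m &
    forall i j, (i < m)%N -> (j < m)%N -> bz xs`_i xs`_j = get T i j.
Proof.
move=> /symbP sT pT.
have hsym (x y : 'rV[int]_m) :
    table_form T x y = (-1) ^+ false * idfun (table_form T y x).
  rewrite expr0 mul1r /= /table_form exchange_big; apply: eq_bigr => i _.
  by apply: eq_bigr => j _; rewrite sT // [x 0 _ * _]mulrC.
have hpos (x : 'rV[int]_m) : x != 0 -> 0 < table_form T x x.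
  move=> x0; pose c k := oapp (fun i : 'I_m => Z_of_int (x 0 i)) 0 (insub k).
  have cE (i : 'I_m) : c i = Z_of_int (x 0 i) by rewrite /c valK.
  have : 0 < quad m T c.
    apply: pdbP => //; have /existsP[i xi] : [exists i, x 0 i != 0].
      apply: contraNT x0 => /existsPn h; apply/eqP/rowP => i; rewrite mxE.
      by apply/eqP; have := h i; rewrite negbK.
    by exists i => //; rewrite cE; move: xi; lia.
  have -> : quad m T c = Z_of_int (table_form T x x).
    rewrite /table_form rmorph_sum; apply: eq_bigr => i _.
    rewrite rmorph_sum; apply: eq_bigr => j _.
    by rewrite !rmorphM /= int_of_ZK !cE.
  by move: (table_form T x x) => a; lia.
pose H := isHermitianSesquilinear.Build int 'rV[int]_m false idfun (table_form T) hsym.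
pose P := isDotProduct.Build int 'rV[int]_m (table_form T) hpos.
pose f : {dot 'rV[int]_m for idfun} := HB.pack (@table_form m T) H P.
exists (@ZLattice 'rV[int]_m f); first by rewrite /zrank /dim /= mul1n.
exists [seq delta_mx 0 i | i : 'I_m].
  by rewrite size_map -cardE card_ord.
move=> i j im jm; rewrite /bz /=.
have nE k (km : (k < m)%N) : [seq delta_mx 0 i | i : 'I_m]`_k = delta_mx 0 (Ordinal km) :> 'rV[int]_m.
  by rewrite (nth_map (Ordinal km)) -?cardE ?card_ord // (nth_ord_enum _ (Ordinal km)).
rewrite !nE /f /= /table_form (bigD1 (Ordinal im)) //= (bigD1 (Ordinal jm)) //=.
rewrite !mxE !eqxx !mul1r !big1 ?addr0 ?int_of_ZK //.
  by move=> k /negbTE nk; rewrite big1 // => l _; rewrite !mxE nk !mul0r.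
by move=> k /negbTE nk; rewrite !mxE nk mulr0 mul0r.
Qed.

Definition sum_form (L1 L2 : zlattice) (u v : (L1 * L2)%type) : int :=
  zform L1 u.1 v.1 + zform L2 u.2 v.2.

Lemma sum_form_bilinear L1 L2 : bilinear_for *%R (idfun \; *%R) (@sum_form L1 L2).
Proof.
split=> u a x y; rewrite /sum_form /=.
  by rewrite !linearDl !linearZl_LR /=; ring.
by rewrite !linearDr !linearZr_LR /=; ring.
Qed.

HB.instance Definition _ (L1 L2 : zlattice) := bilinear_isBilinear.Build int
  (L1 * L2)%type (L1 * L2)%type int
  *%R (idfun \; *%R) (@sum_form L1 L2) (sum_form_bilinear L1 L2).

Lemma orthogonal_sum (L1 L2 : zlattice) : exists2 L : zlattice,
  zrank L = (zrank L1 + zrank L2)%N & represents L L1 /\ represents L L2.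
Proof.
have hsym (x y : (L1 * L2)%type) :
    sum_form x y = (-1) ^+ false * idfun (sum_form y x).
  by rewrite expr0 mul1r /= /sum_form hermC (hermC (zform L2)) !expr0 !mul1r.
have hpos (x : (L1 * L2)%type) : x != 0 -> 0 < sum_form x x.
  have ge0 (l : zlattice) (z : l) : 0 <= zform l z z.
    by case: (eqVneq z 0) => [->|/(neq0_dnorm_gt0 (s := zform l))/ltW //]; rewrite linear0l.
  rewrite /sum_form; case: x => x y; rewrite xpair_eqE negb_and => /orP[] n0.
    by apply: ltr_wpDr (neq0_dnorm_gt0 (s := zform L1) _ n0).
  by apply: ltr_wpDl (neq0_dnorm_gt0 (s := zform L2) _ n0).
pose H := isHermitianSesquilinear.Build int (L1 * L2)%type false idfun (@sum_form L1 L2) hsym.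
pose P := isDotProduct.Build int (L1 * L2)%type (@sum_form L1 L2) hpos.
pose f : {dot (L1 * L2)%type for idfun} := HB.pack (@sum_form L1 L2) H P.
exists (@ZLattice (L1 * L2)%type f) => //; split.
  pose s (x : L1) : (L1 * L2)%type := (x, 0).
  have ls : linear s by move=> a x y; rewrite /s; congr (_, _); rewrite /= scaler0 addr0.
  pose sl := GRing.isLinear.Build _ _ _ _ s ls.
  pose sL : {linear L1 -> (L1 * L2)%type} := HB.pack s sl.
  by exists sL => x y; rewrite /= /sum_form /= linear0l addr0.
pose s (x : L2) : (L1 * L2)%type := (0, x).
have ls : linear s by move=> a x y; rewrite /s; congr (_, _); rewrite /= scaler0 addr0.
pose sl := GRing.isLinear.Build _ _ _ _ s ls.
pose sL : {linear L2 -> (L1 * L2)%type} := HB.pack s sl.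
by exists sL => x y; rewrite /= /sum_form /= linear0l add0r.
Qed.

Lemma represents_refl L : represents L L.
Proof. by exists idfun. Qed.

Lemma represents_trans L M N : represents L M -> represents M N -> represents L N.
Proof. by move=> [f hf] [g hg]; exists (f \o g) => x y; rewrite /= hf hg. Qed.

Lemma represents_pad (L : zlattice) n : (zrank L <= n)%N ->
  exists2 L' : zlattice, zrank L' = n & represents L' L.
Proof.
elim: n => [|n IH]; first by rewrite leqn0 => /eqP z; exists L => //; exact: represents_refl.
rewrite leq_eqVlt => /orP[/eqP z|/IH[M rM hM]]; first by exists L => //; exact: represents_refl.
have [I1 r1 _] : exists2 l : zlattice, zrank l = 1%N & exists2 xs : seq l, size xs = 1%N &
    forall i j, (i < 1)%N -> (j < 1)%N -> bz xs`_i xs`_j = get [:: [:: 1]] i j.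
  exact: lattice_of_table.
have [S rS [SM _]] := orthogonal_sum M I1; exists S; first by rewrite rS rM r1 addn1.
exact: represents_trans SM hM.
Qed.

Lemma represents_gram L (l : zlattice) (xs : seq l) : represents L l ->
  exists2 ys : seq L, size ys = size xs &
    forall i j, (i < size xs)%N -> (j < size xs)%N -> bz ys`_i ys`_j = bz xs`_i xs`_j.
Proof.
case=> s hs; exists (map s xs); first exact: size_map.
by move=> i j ix jx; rewrite !(nth_map 0) // /bz hs.
Qed.

(** * Obstructions to a common lattice *)

Definition carries (L : zlattice) m (T : table) := exists2 xs : seq L, size xs = m &
  forall i j, (i < m)%N -> (j < m)%N -> bz xs`_i xs`_j = get T i j.

Definition valid m T := symb m T && pdb m T.

Lemma simul_tables m n k Ts : simultaneously_represented m n k ->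
  (0 < size Ts <= k)%N -> all (valid m) Ts ->
  exists2 L : zlattice, zrank L = n & {in Ts, forall T, carries L m T}.
Proof.
move=> S /andP[s0 sk] /allP vT; case: k S sk => [|k] S sk.
  by move: (leq_trans s0 sk).
(* Indices beyond the list repeat its first table, so [k] may exceed the number of tables. *)
have lat (i : 'I_k.+1) : exists l : zlattice, zrank l = m /\
    forall L, represents L l -> carries L m (nth (head [::] Ts) Ts i).
  have /vT/andP[sT pT] : nth (head [::] Ts) Ts i \in Ts.
    case: (ltnP i (size Ts)) => h; first exact: mem_nth.
    by rewrite nth_default // -nth0 mem_nth.
  have [l rl [xs sx gx]] := lattice_of_table sT pT; exists l; split=> // L Ll.
  have [ys sy gy] := represents_gram xs Ll; exists ys; first by rewrite sy.
  by move=> a b am bm; rewrite gy ?sx // gx.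
have [l hl] := @fin_all_exists _ _ _ lat.
have [L [rL repL]] := S l (fun i => (hl i).1); exists L => // T TT.
have iT : (index T Ts < k.+1)%N by apply: leq_trans sk; rewrite index_mem.
by have := (hl (Ordinal iT)).2 L (repL _); rewrite /= nth_index.
Qed.

Lemma simul_one m n : (m <= n)%N -> simultaneously_represented m n 1.
Proof.
move=> mn l rl; have [|L rL LL] := represents_pad (L := l ord0) (n := n); first by rewrite rl.
by exists L; split=> // i; rewrite ord1.
Qed.

Lemma simul_two m n : (m + m <= n)%N -> simultaneously_represented m n 2.
Proof.
move=> mn l rl; have [S rS [S1 S2]] := orthogonal_sum (l ord0) (l ord_max).
have [|L rL LS] := represents_pad (L := S) (n := n); first by rewrite rS !rl.
exists L; split=> // i; apply: represents_trans LS _.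
by case: i => [[|[|//]] ?]; [move: S1|move: S2]; congr represents; congr l; apply: val_inj.
Qed.

Lemma simul_bound m N Ts : (0 < size Ts)%N -> all (valid m) Ts ->
  (forall L : zlattice, (zrank L <= N)%N -> {in Ts, forall T, carries L m T} -> False) ->
  forall n k, (n <= N)%N -> simultaneously_represented m n k -> (k <= (size Ts).-1)%N.
Proof.
move=> s0 vT no n k nN S; rewrite leqNgt; apply/negP => sk.
have [|L rL cL] := simul_tables S _ vT; first by rewrite s0 -(prednK s0).
by apply: no cL; rewrite rL.
Qed.

Definition T_I m := mk m (fun i j => if i == j then 1 else 0).

Lemma onb_of_carries L m : carries L m (T_I m) -> exists2 es : seq L, onb es & size es = m.
Proof.
case=> es se ge; exists es => //; have g i j : (i < size es)%N -> (j < size es)%N ->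
    bz es`_i es`_j = (i == j)%:R.
  by rewrite se => im jm; rewrite ge // get_mk //; case: eqP.
have ue : uniq es.
  apply/(uniqP 0) => i j im jm eij; apply: contraTeq isT => /negbTE nij.
  by have := g i j im jm; rewrite eij nij g // eqxx.
split=> // x y /(nthP 0)[i im <-] /(nthP 0)[j jm <-].
by rewrite g // nth_uniq.
Qed.

Section Cases.
Variable L : zlattice.
Implicit Types (es xs ys fs us vs : seq L).

Lemma isres_nil m T xs : size xs = m ->
  (forall i j, (i < m)%N -> (j < m)%N -> bz xs`_i xs`_j = get T i j) -> isres xs [::] T.
Proof. by move=> sx gx i j ix jx; rewrite big_nil subr0 gx // -sx. Qed.

Lemma no_rank2 m T bs es : onb es -> (dim L < size es + 2)%N -> carries L m T ->
  in_bounds m T bs ->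
  csearch (leaf_rank2 m) m (size es) (cands m T bs) T [::] -> False.
Proof.
move=> oe d [xs sx gx] bd h; subst m.
have [es' [R [oe' se rR]]] := search_sound oe (isres_nil erefl gx) bd h.
by rewrite leaf_rank2F // se.
Qed.

(** A smaller rank would give the Gram matrix of [ys] a kernel vector by [gram_det0], against
    positive definiteness. *)
Lemma dim_bound m T es ys : onb es -> size ys = m ->
  (forall i j, (i < m)%N -> (j < m)%N -> bz ys`_i ys`_j = get T i j) ->
  valid m T -> {in ys & es, forall y e, bz y e = 0} -> (size es + m <= dim L)%N.
Proof.
move=> oe <- gy /andP[/symbP sT pT] oy; rewrite leqNgt; apply/negP => d.
have /eqP/det0P[v v0 vG] := gram_det0 oe d oy.
pose c k := oapp (v 0) 0 (insub k).
have cE (i : 'I_(size ys)) : c i = v 0 i by rewrite /c valK.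
have : 0 < quad (size ys) T c.
  apply: pdbP => //; have /existsP[i vi] : [exists i, v 0 i != 0].
    apply: contraNT v0 => /existsPn h; apply/eqP/rowP => i; rewrite mxE.
    by apply/eqP; have := h i; rewrite negbK.
  by exists i => //; rewrite cE.
rewrite /quad exchange_big big1 ?ltxx // => j _.
have := congr1 (fun M : 'rV_(size ys) => M 0 j) vG; rewrite !mxE => h.
rewrite -[RHS](mulr0 (c j)) -[X in _ = _ * X]h mulr_sumr; apply: eq_bigr => i _.
by rewrite !mxE gy // !cE; ring.
Qed.

(** The column of [e] or of [- e] is a candidate, and the only candidate is zero. *)
Lemma unit_vector_orth m T bs xs e : cands m T bs = [:: nseq m Z0] -> in_bounds m T bs ->
  size xs = m ->
  (forall i j, (i < m)%N -> (j < m)%N -> bz xs`_i xs`_j = get T i j) ->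
  bz e e = 1 -> {in xs, forall x, bz x e = 0}.
Proof.
move=> cT bd sx gx e1 x xx; subst m.
have z v : nseq (size xs) Z0 = lam xs v -> bz x v = 0.
  by move=> E; have : bz x v \in lam xs v := map_f _ xx; rewrite -E mem_nseq => /andP[_ /eqP].
case: (cands_complete (isres_nil erefl gx) bd e1); rewrite cT inE => /eqP/esym/z //.
by rewrite bzNr => /eqP; rewrite oppr_eq0 => /eqP.
Qed.

Definition gdet n (F : nat -> nat -> Z) := \det (\matrix_(i < n, j < n) F i j).

Lemma gdet_block a b F :
  (forall i j, (i < a)%N -> (j < b)%N -> F i (a + j)%N = 0) ->
  gdet (a + b) F = gdet a F * gdet b (fun i j => F (a + i)%N (a + j)%N).
Proof.
move=> F0; rewrite /gdet.
have -> : (\matrix_(i < a + b, j < a + b) F i j) =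
    block_mx (\matrix_(i < a, j < a) F i j) 0
      (\matrix_(i < b, j < a) F (a + i)%N j) (\matrix_(i < b, j < b) F (a + i)%N (a + j)%N).
  apply/matrixP => i j; rewrite -[i]splitK -[j]splitK.
  case: (split i) (split j) => i' [] j' /=;
    by rewrite ?block_mxEul ?block_mxEur ?block_mxEdl ?block_mxEdr !mxE //= F0.
exact: det_lblock.
Qed.

(** Each Gram determinant is the determinant of [L] times the square of a coordinate determinant. *)
Lemma gram_square us vs :
  exists k, gdet (dim L) (fun i j => bz us`_i us`_j)
          * gdet (dim L) (fun i j => bz vs`_i vs`_j) = k * k.
Proof.
rewrite /gdet.
have := @gram_mulmx L _ (fun i : 'I_(dim L) => us`_i) (fun i => us`_i); move=> ->.
have := @gram_mulmx L _ (fun i : 'I_(dim L) => vs`_i) (fun i => vs`_i); move=> ->.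
rewrite !det_mulmx !det_tr; set p := \det _; set s := \det _; set q := \det _.
by exists (p * s * q); ring.
Qed.

Definition gram_is xs m T := size xs = m /\
  forall i j, (i < m)%N -> (j < m)%N -> bz xs`_i xs`_j = get T i j.

Definition orth xs ys := {in xs & ys, forall x y, bz x y = 0}.

Lemma gdet_cat xs ys m1 m2 T1 T2 : gram_is xs m1 T1 -> gram_is ys m2 T2 -> orth xs ys ->
  gdet (m1 + m2) (fun i j => bz (xs ++ ys)`_i (xs ++ ys)`_j)
  = gdet m1 (get T1) * gdet m2 (get T2).
Proof.
move=> [sx gx] [sy gy] o; rewrite gdet_block => [|i j im jm]; last first.
  by rewrite !nth_cat sx im ltnNge leq_addr /= addKn o ?mem_nth ?sx ?sy.
congr (_ * _); congr (\det _); apply/matrixP => i j; rewrite !mxE !nth_cat sx.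
  by rewrite !ltn_ord gx.
by rewrite !ltnNge !leq_addr /= !addKn gy.
Qed.

Lemma square_pairs xs ys us vs m1 m2 n1 n2 T1 T2 S1 S2 :
  gram_is xs m1 T1 -> gram_is ys m2 T2 -> orth xs ys -> (m1 + m2)%N = dim L ->
  gram_is us n1 S1 -> gram_is vs n2 S2 -> orth us vs -> (n1 + n2)%N = dim L ->
  exists k, (gdet m1 (get T1) * gdet m2 (get T2))
          * (gdet n1 (get S1) * gdet n2 (get S2)) = k * k.
Proof.
move=> gx gy oxy dm gu gv ouv dn.
rewrite -(gdet_cat gx gy oxy) -(gdet_cat gu gv ouv) dm dn.
exact: gram_square.
Qed.

End Cases.

(** * Determinants and root lattices *)

Fixpoint laplace n (T : table) : Z :=
  if n is n'.+1 then
    foldr (fun j a => Z.add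
      (let t := get T 0 j in
       if Z.eqb t Z0 then Z0 else
       Z.mul (if odd j then Z.opp t else t)
         (laplace n' (mk n' (fun i k => get T i.+1 (bump j k))))) a) Z0 (iota 0 n)
  else Zpos xH.

Lemma laplaceP n T : gdet n (get T) = laplace n T.
Proof.
elim: n T => [|n IH] T; first by rewrite /gdet det_mx00.
rewrite /gdet (expand_det_row _ ord0).
have lapS : laplace n.+1 T = \sum_(j <- iota 0 n.+1)
    (if odd j then - get T 0 j else get T 0 j)
    * laplace n (mk n (fun i k => get T i.+1 (bump j k))).
  rewrite [laplace _ _]/laplace -/laplace; elim: (iota 0 n.+1) => [|j s IHs]; first by rewrite big_nil.
  rewrite big_cons -IHs /=; case: Z.eqb_spec => [->|_] //.
  by rewrite oppr0 if_same mul0r.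
rewrite lapS -[iota _ _]/(index_iota 0 n.+1) big_mkord; apply: eq_bigr => j _.
rewrite mxE /cofactor add0n -IH mulrA; congr (_ * _).
  by rewrite -signr_odd; case: odd; rewrite ?expr1 ?expr0 ?mulr1 ?mulrN1.
congr (\det _); apply/matrixP => i k; rewrite !mxE get_mk //.
Qed.

(* E_n for n = 6, 7, 8: a path on the nodes 0, ..., n - 2 with node n - 1 attached
   to node 2. *)
Definition T_E n := mk n (fun i j =>
  let adj i j := (((i.+1 == j) && (j < n.-1)) || ((i == 2) && (j == n.-1)))%N in
  if i == j then 2 else if adj i j || adj j i then -1 else 0).
Definition T_A n := mk n (fun i j =>
  if i == j then 2 else if (i.+1 == j) || (j.+1 == i) then -1 else 0).
(* A_6 and a vector of norm c dual to its second root. The test lattice is c = 3;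
   the values 1 and 2 occur for projections of that vector. *)
Definition T_A6_glue c := mk 7 (fun i j =>
  if (i < 6)%N && (j < 6)%N then get (T_A 6) i j
  else if i == j then c else if (i == 1%N) || (j == 1%N) then 1 else 0).
Definition T_377 := mk 3 (fun i j => if i == j then if i == 0%N then 3 else 7 else 0).
Definition T_245_15 := mk 5 (fun i j =>
  if (i < 4)%N && (j < 4)%N then get T_245 i j else if i == j then 15 else 0).

Lemma valid_E6 : valid 6 (T_E 6). Proof. by vm_compute. Qed.
Lemma bounds_E6 : in_bounds 6 (T_E 6) (nseq 6 1%N). Proof. by vm_compute. Qed.
(** For positive definite [G], semidefiniteness of [G - l l^T] means that [l], as a dual vector, has
    norm at most 1. Nonzero dual vectors of [E_6], [E_7], [E_8] have norm at least 4/3, 3/2, 2. *)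
Lemma cands_E6 : cands 6 (T_E 6) (nseq 6 1%N) = [:: nseq 6 Z0].
Proof. by vm_cast_no_check (erefl [:: nseq 6 Z0]). Qed.
Lemma valid_E7 : valid 7 (T_E 7). Proof. by vm_compute. Qed.
Lemma bounds_E7 : in_bounds 7 (T_E 7) (nseq 7 1%N). Proof. by vm_compute. Qed.
Lemma cands_E7 : cands 7 (T_E 7) (nseq 7 1%N) = [:: nseq 7 Z0].
Proof. by vm_cast_no_check (erefl [:: nseq 7 Z0]). Qed.
Lemma valid_E8 : valid 8 (T_E 8). Proof. by vm_compute. Qed.
Lemma bounds_E8 : in_bounds 8 (T_E 8) (nseq 8 1%N). Proof. by vm_compute. Qed.
Lemma cands_E8 : cands 8 (T_E 8) (nseq 8 1%N) = [:: nseq 8 Z0].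
Proof. by vm_cast_no_check (erefl [:: nseq 8 Z0]). Qed.

Lemma det_I6 : gdet 6 (get (T_I 6)) = 1. Proof. by rewrite laplaceP; vm_compute. Qed.
Lemma det_I7 : gdet 7 (get (T_I 7)) = 1. Proof. by rewrite laplaceP; vm_compute. Qed.
Lemma det_E6 : gdet 6 (get (T_E 6)) = 3. Proof. by rewrite laplaceP; vm_compute. Qed.
Lemma det_E7 : gdet 7 (get (T_E 7)) = 2. Proof. by rewrite laplaceP; vm_compute. Qed.
Lemma det_A6 : gdet 6 (get (T_A 6)) = 7. Proof. by rewrite laplaceP; vm_compute. Qed.
Lemma det_A6_glue1 : gdet 7 (get (T_A6_glue 1)) = - 3.
Proof. by rewrite laplaceP; vm_compute. Qed.
Lemma det_A6_glue2 : gdet 7 (get (T_A6_glue 2)) = 4.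
Proof. by rewrite laplaceP; vm_compute. Qed.
Lemma det_A6_glue3 : gdet 7 (get (T_A6_glue 3)) = 11.
Proof. by rewrite laplaceP; vm_compute. Qed.

Lemma not_square (r k : Z) : 0 <= r -> r * r < k * k < (r + 1) * (r + 1) -> False.
Proof.
move=> r0 /andP[h1 h2]; have k0 := normr_ge0 k.
have kk : k * k = `|k| * `|k| by rewrite -normrM ger0_norm // -expr2 sqr_ge0.
rewrite kk {kk} in h1 h2; move: `|k| k0 h1 h2 => K k0 h1 h2.
have [h|h] : K <= r \/ r + 1 <= K by lia.
  by have := ler_pM k0 k0 h h; lia.
by have := ler_pM (addr_ge0 r0 ler01) (addr_ge0 r0 ler01) h h; lia.
Qed.

(** * Ranks 6, 7 and 8 *)

Section Split.
Variables (L : zlattice) (n : nat) (T : table) (bs : seq nat) (es fs : seq L).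
Hypotheses (oe : onb es) (se : size es = n) (gf : gram_is fs n T) (vT : valid n T).
Hypotheses (cT : cands n T bs = [:: nseq n Z0]) (bd : in_bounds n T bs).

Lemma split_orth : orth fs es.
Proof.
case: gf => sf gf' x e xf ee; apply: (unit_vector_orth cT bd sf gf') => //.
by case: oe => _ /(_ e e ee ee) ->; rewrite eqxx.
Qed.

Lemma split_dim : (n + n <= dim L)%N.
Proof. by case: gf => sf gf'; rewrite -{1}se; apply: dim_bound oe sf gf' vT split_orth. Qed.

Hypothesis dL : dim L = (n + n)%N.

(** Adjoining [y] to [es] would give [n + 1] orthonormal vectors orthogonal to the rank [n] family
    [fs], too many for rank [2 n]. *)
Lemma no_unit y : {in es, forall e, bz y e = 0} -> bz y y = 1 -> False.
Proof.
move=> oy y1; have oe' := onb_cons oe y1 oy.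
case: gf => sf gf'; have : (size (y :: es) + n <= dim L)%N.
  apply: (dim_bound oe' sf gf' vT) => x e xf; rewrite inE => /orP[/eqP ->|ee].
    exact: (unit_vector_orth cT bd sf gf').
  exact: split_orth.
by rewrite /= se dL addSn ltnn.
Qed.

Lemma res_norm z : bz (res es z) (res es z) = bz z z - \sum_(e <- es) bz z e ^+ 2.
Proof. by rewrite bz_res. Qed.

Lemma res_norm_neq1 z : bz (res es z) (res es z) <> 1.
Proof. by apply: no_unit => e ee; rewrite res_orth. Qed.

Lemma sum_sqr_ge0 z : 0 <= \sum_(e <- es) bz z e ^+ 2.
Proof. by apply: sumr_ge0 => e _; exact: sqr_ge0. Qed.

Lemma full_norm z : bz (res es z) (res es z) = bz z z -> {in es, forall e, bz z e = 0}.
Proof.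
rewrite res_norm => h; have : \sum_(e <- es) bz z e ^+ 2 == 0.
  by apply/eqP; clear - h; lia.
rewrite psumr_eq0 => [/allP a e ee|e _]; last exact: sqr_ge0.
by have := a e ee; rewrite sqrf_eq0 => /eqP.
Qed.

Lemma span_orth z y : res es z = 0 -> {in es, forall e, bz y e = 0} -> bz z y = 0.
Proof.
move=> rz oy; rewrite -(@bz_res_orth L es z y) ?rz ?bz0l // => e ee.
by rewrite bzC oy.
Qed.

(** The residual has norm 0, 1 or 2, and 1 is excluded by [no_unit]; norm 2 means that nothing was
    projected away. *)
Lemma root_case a : bz a a = 2 -> res es a = 0 \/ {in es, forall e, bz a e = 0}.
Proof.
move=> a2; have := res_norm a; have := sum_sqr_ge0 a.
have := bz_ge0 (res es a); have := @res_norm_neq1 a.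
set r := bz _ (res es a) => r1 r0 s0 rE.
have [/bz_eq0|] : r = 0 \/ r = 2 by rewrite a2 in rE; lia.
  by left.
by rewrite -a2 => /full_norm; right.
Qed.

(** A vector with zero residual is orthogonal to every vector orthogonal to [es], but neighbours are
    not orthogonal; so the alternative of [root_case] is constant along the chain. *)
Lemma chain_case (a : nat -> L) k : (forall i, (i < k)%N -> bz (a i) (a i) = 2) ->
  (forall i, (i.+1 < k)%N -> bz (a i) (a i.+1) != 0) ->
  (forall i, (i < k)%N -> res es (a i) = 0) \/
  (forall i, (i < k)%N -> {in es, forall e, bz (a i) e = 0}).
Proof.
elim: k => [|k IH] a2 an; first by left.
have [i ik|i ik||] := IH; [exact/a2/ltnW | exact/an/ltnW | |]; rewrite ?ltnS //.
- move=> IHl; case: (root_case (a2 k (ltnSn k))) => [rk|ok].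
    by left=> i; rewrite ltnS leq_eqVlt => /orP[/eqP -> //|/IHl].
  case: k IHl ok an {IH a2} => [|k] IHl ok an.
    by right=> i; rewrite ltnS leqn0 => /eqP ->.
  by have := an k (ltnSn _); rewrite (span_orth (IHl k (ltnSn k)) ok) eqxx.
- move=> IHr; case: (root_case (a2 k (ltnSn k))) => [rk|ok]; last first.
    by right=> i; rewrite ltnS leq_eqVlt => /orP[/eqP -> //|/IHr].
  case: k IHr rk an {IH a2} => [|k] IHr rk an.
    by left=> i; rewrite ltnS leqn0 => /eqP ->.
  by have := an k (ltnSn _); rewrite bzC (span_orth rk (IHr k (ltnSn k))) eqxx.
Qed.

End Split.

Lemma gram_I (L : zlattice) (es : seq L) n : onb es -> size es = n -> gram_is es n (T_I n).
Proof.
move=> [ue oe] se; split=> // i j im jm; rewrite get_mk // oe ?mem_nth ?se //.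
by rewrite nth_uniq ?se //; case: eqP.
Qed.

Lemma orthC (L : zlattice) (xs ys : seq L) : orth xs ys -> orth ys xs.
Proof. by move=> o y x yy xx; rewrite bzC o. Qed.

(** The pair [I_6], [E_6] has determinant product 3. Over the span of [I_6], [A_6] pairs with [E_6]
    to give 21, and 63 is not a square; orthogonal to [I_6], it pairs with [I_6] to give 7, and 21
    is not a square. *)
Lemma no_lattice_6_12 (L : zlattice) : (zrank L <= 12)%N ->
  {in [:: T_I 6; T_E 6; T_A 6], forall T, carries L 6 T} -> False.
Proof.
move=> rL cL.
have [es oe se] := onb_of_carries (cL _ (mem_head _ _)).
have [fs sf gf] := cL (T_E 6) isT; have [a sa ga] := cL (T_A 6) isT.
have gF : gram_is fs 6 (T_E 6) by [].
have dL : dim L = (6 + 6)%N.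
  by apply/eqP; rewrite eqn_leq rL (split_dim oe se gF valid_E6 cands_E6 bounds_E6).
have oF := split_orth oe gF cands_E6 bounds_E6.
have [i i6|i i6|ra|oa] := chain_case oe se gF valid_E6 cands_E6 bounds_E6 dL (a := nth 0 a) (k := 6).
- by rewrite ga // get_mk // eqxx.
- by rewrite ga ?(ltnW i6) // get_mk ?(ltnW i6) // (ltn_eqF (ltnSn i)) eqxx.
- have oaf : orth a fs.
    move=> x f /(nthP 0)[i]; rewrite sa => i6 <- ff.
    by apply: (span_orth (ra i i6)) => e ee; exact: oF.
  have [k] := square_pairs (conj sa ga) gF oaf (esym dL)
    (gram_I oe se) gF (orthC oF) (esym dL).
  by rewrite det_A6 det_E6 det_I6 => h; apply: (@not_square 7 k); rewrite -?h; vm_compute.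
- have oea : orth es a.
    by move=> e x ee /(nthP 0)[i]; rewrite sa bzC => i6 <-; exact: oa.
  have [k] := square_pairs (gram_I oe se) (conj sa ga) oea (esym dL)
    (gram_I oe se) gF (orthC oF) (esym dL).
  by rewrite det_A6 det_E6 det_I6 => h; apply: (@not_square 4 k); rewrite -?h; vm_compute.
Qed.

Lemma get_A6_glue c i j : (i < 7)%N -> (j < 7)%N -> get (T_A6_glue c) i j =
  if (i < 6)%N && (j < 6)%N then get (T_A 6) i j
  else if i == j then c else if (i == 1%N) || (j == 1%N) then 1 else 0.
Proof. exact: get_mk. Qed.

(* If A_6 lies over the span of I_7, the extra vector v decomposes along I_7 and
   E_7 with an E_7-part of norm 0, 2 or 3: the first two give a rank 7 family
   orthogonal to E_7, and in the last v is orthogonal to A_6. If A_6 is orthogonal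
   to I_7, the norms 2 and 3 give such a family orthogonal to I_7. *)
Lemma no_lattice_7_14 (L : zlattice) : (zrank L <= 14)%N ->
  {in [:: T_I 7; T_E 7; T_A6_glue 3], forall T, carries L 7 T} -> False.
Proof.
move=> rL cL.
have [es oe se] := onb_of_carries (cL _ (mem_head _ _)).
have [fs sf gf] := cL (T_E 7) isT; have [a sa ga] := cL (T_A6_glue 3) isT.
have gF : gram_is fs 7 (T_E 7) by [].
have dL : dim L = (7 + 7)%N.
  by apply/eqP; rewrite eqn_leq rL (split_dim oe se gF valid_E7 cands_E7 bounds_E7).
have oF := split_orth oe gF cands_E7 bounds_E7.
have gI := gram_I oe se.
pose v := a`_6; pose v' := res es v.
have lt7 i : (i < 6)%N -> (i < 7)%N by move/ltn_trans; apply.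
have gaE i j : (i < 6)%N -> (j < 6)%N -> bz a`_i a`_j = get (T_A 6) i j.
  by move=> i6 j6; rewrite ga ?lt7 // get_A6_glue ?lt7 // i6 j6.
have gav i : (i < 6)%N -> bz a`_i v = (i == 1%N)%:R.
  move=> i6; have i7 := lt7 i i6; rewrite ga // get_A6_glue //.
  by rewrite andbF (ltn_eqF i6) orbF; case: eqP.
have vv : bz v v = 3 by rewrite ga // get_A6_glue.
(* Any [w] with the same products with the six roots may replace [v]; only the norm [c] changes. *)
have glue c w : bz w w = c -> (forall i, (i < 6)%N -> bz a`_i w = (i == 1%N)%:R) ->
    gram_is (rcons (take 6 a) w) 7 (T_A6_glue c).
  move=> wc aw; have s6 : size (take 6 a) = 6 by rewrite size_takel ?sa.
  split=> [|i j i7 j7]; first by rewrite size_rcons s6.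
  rewrite !nth_rcons s6 get_A6_glue //.
  case: (ltnP i 6) => i6; case: (ltnP j 6) => j6 /=.
  - by rewrite !nth_take // gaE.
  - have -> : j = 6%N by apply/eqP; rewrite eqn_leq j6 -ltnS j7.
    by rewrite eqxx nth_take // aw // (ltn_eqF i6) orbF; case: eqP.
  - have -> : i = 6%N by apply/eqP; rewrite eqn_leq i6 -ltnS i7.
    by rewrite eqxx nth_take // bzC aw // (gtn_eqF j6) /=; case: eqP.
  - have -> : i = 6%N by apply/eqP; rewrite eqn_leq i6 -ltnS i7.
    have -> : j = 6%N by apply/eqP; rewrite eqn_leq j6 -ltnS j7.
    by rewrite eqxx.
have rv : [\/ bz v' v' = 0, bz v' v' = 2 | bz v' v' = 3].
  have := res_norm oe v; have := sum_sqr_ge0 es v; rewrite vv.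
  have := res_norm_neq1 oe se gF valid_E7 cands_E7 bounds_E7 dL (z := v); rewrite -/v'.
  have := bz_ge0 v'; set r := bz v' v' => *.
  have [|[]] : r = 0 \/ r = 2 \/ r = 3 by lia.
  - by constructor 1.
  - by constructor 2.
  - by constructor 3.
have orc (xs ys : seq L) w : {in xs & ys, forall x y, bz x y = 0} ->
    {in ys, forall y, bz w y = 0} -> orth (rcons xs w) ys.
  by move=> h hw x y; rewrite mem_rcons inE => /orP[/eqP ->|xx] yy; [apply: hw|apply: h].
have tk x : x \in take 6 a -> exists2 i, (i < 6)%N & x = a`_i.
  move/(nthP 0) => [i]; rewrite size_takel ?sa // => i6 <-; exists i => //.
  by rewrite nth_take.
have [i i6|i i6|ra|oa] := chain_case oe se gF valid_E7 cands_E7 bounds_E7 dL (a := nth 0 a) (k := 6).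
- by rewrite gaE // get_mk // eqxx.
- by rewrite gaE ?(ltnW i6) // get_mk ?(ltnW i6) // (ltn_eqF (ltnSn i)) eqxx.
- have oaf : {in take 6 a & fs, forall x f, bz x f = 0}.
    move=> x f /tk[i i6 ->] ff; apply: (span_orth (ra i i6)) => e ee; exact: oF.
  case: rv => [/bz_eq0 v0|v2|v3].
  + have ov : {in fs, forall f, bz v f = 0}.
      by move=> f ff; apply: (span_orth v0) => e ee; exact: oF.
    (* The product is [11 * 2 * 2 = 44], between 36 and 49. *)
    have [k] := square_pairs (glue _ _ vv gav) gF (orc _ _ _ oaf ov) (esym dL)
      gI gF (orthC oF) (esym dL).
    by rewrite det_A6_glue3 det_E7 det_I7 => h; apply: (@not_square 6 k); rewrite -?h; vm_compute.
  (* [x] is the part of [v] along [I_7]: it has norm [3 - 2 = 1] and the same products with [A_6] as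
     [v]. *)
  + pose x := v - v'.
    have ve : {in es, forall e, bz v' e = 0} by move=> e ee; rewrite res_orth.
    have av' i : (i < 6)%N -> bz a`_i v' = 0.
      by move=> i6; apply: (span_orth (ra i i6)); exact: ve.
    have vv' : bz v v' = bz v' v'.
      by rewrite -(@bz_res_orth L es v) // => e ee; rewrite bzC ve.
    have xx : bz x x = 1.
      have normB b c : bz (b - c) (b - c) = bz b b - bz b c - bz b c + bz c c :> Z.
        by rewrite !(bzDl, bzDr, bzNl, bzNr) (bzC c b); lia.
      by rewrite normB vv' v2 vv.
    have ax i : (i < 6)%N -> bz a`_i x = (i == 1%N)%:R.
      by move=> i6; rewrite bzDr bzNr gav // av' // subr0.
    have ox : {in fs, forall f, bz x f = 0}.
      move=> f ff; rewrite [bz _ _]bzDl bzNl bz_res_orth ?subrr // => e ee.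
      by rewrite bzC oF.
    have [k] := square_pairs (glue _ _ xx ax) gF (orc _ _ _ oaf ox) (esym dL)
      gI gF (orthC oF) (esym dL).
    (* The product [-3 * 2 * 2] is negative. *)
    rewrite det_A6_glue1 det_E7 det_I7 => h.
    by have := sqr_ge0 k; rewrite expr2 -h.
  (* Here [v] is orthogonal to [I_7], hence to [A_6], against its product 1 with the second root. *)
  + have := full_norm oe (z := v); rewrite -/v' v3 vv => /(_ erefl) ve.
    by have := gav 1%N isT; rewrite (span_orth (ra 1%N isT) ve).
- have oae : {in take 6 a & es, forall x e, bz x e = 0}.
    by move=> x e /tk[i i6 ->]; exact: oa.
  case: rv => [/bz_eq0 v0|v2|v3].
  (* Now [v] lies in the span of [I_7] and [A_6] is orthogonal to it: the same contradiction. *)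
  + by have := gav 1%N isT; rewrite bzC (span_orth v0 (oa 1%N isT)).
  + have av' i : (i < 6)%N -> bz a`_i v' = (i == 1%N)%:R.
      move=> i6; rewrite bzC /v' bz_res_orth ?(bzC v) ?gav // => e ee.
      by rewrite bzC oa.
    have ov' : {in es, forall e, bz v' e = 0} by move=> e ee; rewrite res_orth.
    (* The products here and in the last case are 8 and 22. *)
    have [k] := square_pairs gI (glue _ _ v2 av') (orthC (orc _ _ _ oae ov')) (esym dL)
      gI gF (orthC oF) (esym dL).
    by rewrite det_A6_glue2 det_E7 det_I7 => h; apply: (@not_square 2 k); rewrite -?h; vm_compute.
  + have := full_norm oe (z := v); rewrite -/v' v3 vv => /(_ erefl) ve.
    have [k] := square_pairs gI (glue _ _ vv gav) (orthC (orc _ _ _ oae ve)) (esym dL)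
      gI gF (orthC oF) (esym dL).
    by rewrite det_A6_glue3 det_E7 det_I7 => h; apply: (@not_square 4 k); rewrite -?h; vm_compute.
Qed.

Lemma no_lattice_I_E n bs (L : zlattice) : valid n (T_E n) -> in_bounds n (T_E n) bs ->
  cands n (T_E n) bs = [:: nseq n Z0] -> (zrank L < n + n)%N ->
  {in [:: T_I n; T_E n], forall T, carries L n T} -> False.
Proof.
move=> vE bE cE rL cL.
have [es oe se] := onb_of_carries (cL _ (mem_head _ _)).
have [|fs sf gf] := cL (T_E n); first by rewrite !inE eqxx orbT.
have gF : gram_is fs n (T_E n) by [].
by have := split_dim oe se gF vE cE bE; rewrite leqNgt rL.
Qed.

(** * Ranks 3, 4 and 5 *)

Lemma no_lattice_3_4 (L : zlattice) : (zrank L <= 4)%N ->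
  {in [:: T_I 3; T_133], forall T, carries L 3 T} -> False.
Proof.
move=> rL cL; have [es oe se] := onb_of_carries (cL _ (mem_head _ _)).
have dL : (dim L < size es + 2)%N by rewrite se.
have := no_rank2 oe dL (cL T_133 isT) (bs := [:: 1; 1; 1]%N) isT.
by rewrite se => /(_ search_133).
Qed.

Lemma no_lattice_4_5 (L : zlattice) : (zrank L <= 5)%N ->
  {in [:: T_I 4; T_1133], forall T, carries L 4 T} -> False.
Proof.
move=> rL cL; have [es oe se] := onb_of_carries (cL _ (mem_head _ _)).
have dL : (dim L < size es + 2)%N by rewrite se.
have := no_rank2 oe dL (cL T_1133 isT) (bs := [:: 1; 1; 1; 1]%N) isT.
by rewrite se => /(_ search_1133).
Qed.

Lemma get_245_15 i j : (i < 5)%N -> (j < 5)%N -> get T_245_15 i j =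
  if (i < 4)%N && (j < 4)%N then get T_245 i j else if i == j then 15 else 0.
Proof. exact: get_mk. Qed.

(** The first four vectors drive the search; the fifth, orthogonal to them and of norm 15, is the
    vector that [leaf_orth] excludes. *)
Lemma no_lattice_5_7 (L : zlattice) : (zrank L <= 7)%N ->
  {in [:: T_I 5; T_245_15], forall T, carries L 5 T} -> False.
Proof.
move=> rL cL; have [es oe se] := onb_of_carries (cL _ (mem_head _ _)).
have [xs sx gx] := cL T_245_15 isT.
have s4 : size (take 4 xs) = 4%N by rewrite size_takel ?sx.
have lt5 i : (i < 4)%N -> (i < 5)%N by move/ltn_trans; apply.
have gx4 i j : (i < 4)%N -> (j < 4)%N -> bz (take 4 xs)`_i (take 4 xs)`_j = get T_245 i j.
  by move=> i4 j4; rewrite !nth_take // gx ?lt5 // get_245_15 ?lt5 // i4 j4.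
have := search_sound (leaf := leaf_orth 4 (ball_slack 5 15)) oe (isres_nil s4 gx4)
  (bs := [:: 2; 2; 2; 2]%N).
rewrite s4 se => /(_ isT search_245_15) [es' [R [oe' se' rR]]].
have := leaf_orthF oe' rR (n := 15) (w := xs`_4); rewrite s4 se' ltnS => -> //.
- by move=> i i4; have i5 := lt5 i i4; rewrite nth_take // gx // get_245_15 //= (gtn_eqF i4).
- by rewrite gx // get_245_15.
Qed.

(** [I_3] and two residuals of [T_75] give coordinates on [L], in which the search finds no
    orthogonal vectors of norms 3, 7, 7. *)
Lemma no_lattice_3_5 (L : zlattice) : (zrank L <= 5)%N ->
  {in [:: T_I 3; T_75; T_377], forall T, carries L 3 T} -> False.
Proof.
move=> rL cL; have [es oe se] := onb_of_carries (cL _ (mem_head _ _)).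
have [xs sx gx] := cL T_75 isT; have [zs sz gz] := cL T_377 isT.
have := search_sound (leaf := leaf_diag 3 3 [:: 3; 7; 7]%N 6) oe (isres_nil sx gx)
  (bs := [:: 2; 2; 2]%N).
rewrite sx se => /(_ isT search_75_377) [es' [R [oe' se' rR]]].
have := leaf_diagF oe' rR (ns := [:: 3; 7; 7]%N) 6 (zs := zs).
rewrite sx se' ltnS => -> //.
- by case=> [|[|[|//]]] _; rewrite gz // get_mk.
- apply/(pairwiseP 0) => i j; rewrite !inE sz => i3 j3 ij.
  by rewrite gz // get_mk // (ltn_eqF ij).
Qed.

(** [A_4] forces a fifth unit vector. Five of them in rank 6 leave residuals of rank at most 1,
    while [T_245] needs at least 2. *)
Lemma no_lattice_4_6 (L : zlattice) : (zrank L <= 6)%N ->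
  {in [:: T_I 4; T_A4; T_245], forall T, carries L 4 T} -> False.
Proof.
move=> rL cL; have [es oe se] := onb_of_carries (cL _ (mem_head _ _)).
have [xs sx gx] := cL T_A4 isT.
have := search_sound (leaf := leaf_unit 4) oe (isres_nil sx gx) (bs := [:: 1; 1; 1; 1]%N).
rewrite sx se => /(_ isT search_A4) [es' [R [oe' se' rR lf]]].
have [||f f1 fo] := leaf_unitP oe' rR; rewrite ?se' ?ltnS ?sx //.
have oe2 := onb_cons oe' f1 fo.
have dL : (dim L < size (f :: es') + 2)%N by rewrite /= se'.
have := no_rank2 oe2 dL (cL T_245 isT) (bs := [:: 2; 2; 2; 2]%N) isT.
by rewrite [size _]/= se' => /(_ search_245).
Qed.

(** * Values of kappa *)

Lemma kappa_one m N T1 T2 : valid m T1 -> valid m T2 ->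
  (forall L : zlattice, (zrank L <= N)%N ->
     {in [:: T1; T2], forall T, carries L m T} -> False) ->
  forall n, (m <= n <= N)%N -> is_kappa m n 1.
Proof.
move=> v1 v2 no n /andP[mn nN]; split; first exact: simul_one.
by move=> k; apply: (simul_bound (Ts := [:: T1; T2]) isT _ no nN); rewrite /= v1 v2.
Qed.

Lemma kappa_le_two m N T1 T2 T3 : valid m T1 -> valid m T2 -> valid m T3 ->
  (forall L : zlattice, (zrank L <= N)%N ->
     {in [:: T1; T2; T3], forall T, carries L m T} -> False) ->
  forall k, simultaneously_represented m N k -> (k <= 2)%N.
Proof.
move=> v1 v2 v3 no k.
by apply: (simul_bound (Ts := [:: T1; T2; T3]) isT _ no (leqnn N)); rewrite /= v1 v2 v3.
Qed.

(** Whether any two lattices fit in a common one is left undecided, so excluded middle selects the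
    value. *)
Lemma kappa_exists m n : (m <= n)%N ->
  (forall k, simultaneously_represented m n k -> (k <= 2)%N) ->
  exists k, is_kappa m n k /\ (1 <= k <= 2)%N.
Proof.
move=> mn le2; case: (classic (simultaneously_represented m n 2)) => [S|nS].
  by exists 2%N; split.
exists 1%N; split=> //; split; first exact: simul_one.
move=> k Sk; have := le2 k Sk; rewrite leq_eqVlt => /orP[/eqP k2|//].
by case: nS; rewrite -k2.
Qed.

Lemma is_uZ_inj m u u' : is_uZ m u -> is_uZ m u' -> u = u'.
Proof.
move=> [[L [<- UL]] le_u] [[L' [<- UL']] le_u'].
by apply/eqP; rewrite eqn_leq le_u // le_u'.
Qed.

Lemma kappa_3 n : (3 <= n <= 4)%N -> is_kappa 3 n 1.
Proof. by apply: kappa_one no_lattice_3_4 _; vm_compute. Qed.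
Lemma kappa_4 n : (4 <= n <= 5)%N -> is_kappa 4 n 1.
Proof. by apply: kappa_one no_lattice_4_5 _; vm_compute. Qed.
Lemma kappa_5 n : (5 <= n <= 7)%N -> is_kappa 5 n 1.
Proof. by apply: kappa_one no_lattice_5_7 _; vm_compute. Qed.
Lemma kappa_6 n : (6 <= n <= 11)%N -> is_kappa 6 n 1.
Proof.
have vI : valid 6 (T_I 6) by vm_compute.
apply: (kappa_one vI valid_E6) => L rL.
by apply: (no_lattice_I_E valid_E6 bounds_E6 cands_E6).
Qed.
Lemma kappa_7 n : (7 <= n <= 13)%N -> is_kappa 7 n 1.
Proof.
have vI : valid 7 (T_I 7) by vm_compute.
apply: (kappa_one vI valid_E7) => L rL.
by apply: (no_lattice_I_E valid_E7 bounds_E7 cands_E7).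
Qed.
Lemma kappa_8 n : (8 <= n <= 15)%N -> is_kappa 8 n 1.
Proof.
have vI : valid 8 (T_I 8) by vm_compute.
apply: (kappa_one vI valid_E8) => L rL.
by apply: (no_lattice_I_E valid_E8 bounds_E8 cands_E8).
Qed.

Lemma kappa_6_12 : is_kappa 6 12 2.
Proof.
split; first exact: simul_two.
by apply: kappa_le_two no_lattice_6_12; vm_compute.
Qed.
Lemma kappa_7_14 : is_kappa 7 14 2.
Proof.
split; first exact: simul_two.
by apply: kappa_le_two no_lattice_7_14; vm_compute.
Qed.

Local Close Scope ring_scope.

Theorem theorem4p1 :
  (* (i) *)
  ((forall n : nat, n \in [:: 3; 4] -> is_kappa 3 n 1) /\
   (forall n : nat, n \in [:: 4; 5] -> is_kappa 4 n 1) /\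
   (forall n : nat, n \in [:: 5; 6] -> is_kappa 5 n 1) /\
   (forall n : nat, 6 <= n <= 11 -> is_kappa 6 n 1) /\
   (forall n : nat, 7 <= n <= 13 -> is_kappa 7 n 1) /\
   (forall n : nat, 8 <= n <= 14 -> is_kappa 8 n 1) /\
   (known_uZ_values ->
    forall m n u : nat, 3 <= m <= 8 -> is_uZ m u -> m <= n < u - 1 ->
      is_kappa m n 1)) /\
  (* (ii) *)
  ((exists k : nat, is_kappa 3 5 k /\ 1 <= k <= 2) /\
   (exists k : nat, is_kappa 4 6 k /\ 1 <= k <= 2) /\
   is_kappa 5 7 1 /\
   is_kappa 6 12 2 /\
   is_kappa 7 14 2 /\
   is_kappa 8 15 1).
Proof.
split; last first.
  split; first by apply: kappa_exists => //; apply: kappa_le_two no_lattice_3_5; vm_compute.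
  split; first by apply: kappa_exists => //; apply: kappa_le_two no_lattice_4_6; vm_compute.
  split; first exact: kappa_5.
  split; first exact: kappa_6_12.
  by split; [exact: kappa_7_14 | exact: kappa_8].
split; first by move=> n; rewrite !inE => /orP[] /eqP ->; exact: kappa_3.
split; first by move=> n; rewrite !inE => /orP[] /eqP ->; exact: kappa_4.
split; first by move=> n; rewrite !inE => /orP[] /eqP ->; exact: kappa_5.
split; first exact: kappa_6.
split; first exact: kappa_7.
split; first by move=> n nP; apply: kappa_8; lia.
(* Uniqueness of the minimal rank replaces [u] by its known value, leaving a numeric range for [n]
   in each case. *)
move=> [[u3 u4 u5] [u6 u7 u8]] m n u m38 um.
have : m \in iota 3 6 by rewrite mem_iota; lia.
rewrite !inE => /orP[|/orP[|/orP[|/orP[|/orP[|]]]]] /eqP E; subst m.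
- by rewrite (is_uZ_inj um u3) => h; apply: kappa_3; lia.
- by rewrite (is_uZ_inj um u4) => h; apply: kappa_4; lia.
- by rewrite (is_uZ_inj um u5) => h; apply: kappa_5; lia.
- by rewrite (is_uZ_inj um u6) => h; apply: kappa_6; lia.
- by rewrite (is_uZ_inj um u7) => h; apply: kappa_7; lia.
- by rewrite (is_uZ_inj um u8) => h; apply: kappa_8; lia.
Qed.
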